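(* Let $k>0$ and let $E_k$ be the Dunkl kernel of the root system $A_2$ with multiplicity $k$. For $\lambda\in C^+$ and $X\in\mathfrak a$ the following estimates hold, with implied constants depending only on $k$ (uniform in $\lambda\in C^+$ and in $X$ in the indicated region): (i) If $x_1\ge x_2\ge x_3$: $E_k(X,\lambda)\asymp \dfrac{e^{\langle\lambda,X\rangle}}{(1+\alpha_\lambda\alpha_X)^k(1+\beta_\lambda\beta_X)^k(1+\gamma_\lambda\gamma_X)^k}$. (ii) If $x_2\ge x_1\ge x_3$: $E_k(X,\lambda)\asymp \dfrac{e^{\langle\lambda,X^+\rangle}}{(1+\alpha_\lambda\alpha_{X^+})^{k+1}(1+\beta_\lambda\beta_{X^+})^k(1+\gamma_\lambda\gamma_{X^+})^k}$. If $x_1\ge x_3\ge x_2$: $E_k(X,\lambda)\asymp \dfrac{e^{\langle\lambda,X^+\rangle}}{(1+\alpha_\lambda\alpha_{X^+})^{k}(1+\beta_\lambda\beta_{X^+})^{k+1}(1+\gamma_\lambda\gamma_{X^+})^k}$. (iii) If $x_2\ge x_3\ge x_1$: $E_k(X,\lambda)\asymp \dfrac{e^{\langle\lambda,X^+\rangle}}{(1+\alpha_\lambda\alpha_{X^+})^{k+1}(1+\beta_\lambda\beta_{X^+})^{k+1}(1+\gamma_\lambda\gamma_{X^+})^k}$ if $\alpha_\lambda\le\beta_\lambda$; $E_k(X,\lambda)\asymp \dfrac{e^{\langle\lambda,X^+\rangle}}{(1+\alpha_\lambda\alpha_{X^+})^{k}(1+\beta_\lambda\beta_{X^+})^{k+1}(1+\gamma_\lambda\gamma_{X^+})^{k+1}}$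 if $\alpha_\lambda\ge\beta_\lambda$ and $\alpha_\lambda\alpha_{X^+}\ge\beta_\lambda\beta_{X^+}$; $E_k(X,\lambda)\asymp \dfrac{e^{\langle\lambda,X^+\rangle}}{(1+\alpha_\lambda\alpha_{X^+})^{k+1}(1+\beta_\lambda\beta_{X^+})^{k}(1+\gamma_\lambda\gamma_{X^+})^{k+1}}$ if $\alpha_\lambda\ge\beta_\lambda$ and $\alpha_\lambda\alpha_{X^+}\le\beta_\lambda\beta_{X^+}$. (iv) If $x_3\ge x_1\ge x_2$: $E_k(X,\lambda)\asymp \dfrac{e^{\langle\lambda,X^+\rangle}}{(1+\alpha_\lambda\alpha_{X^+})^{k+1}(1+\beta_\lambda\beta_{X^+})^{k+1}(1+\gamma_\lambda\gamma_{X^+})^k}$ if $\beta_\lambda\le\alpha_\lambda$; $E_k(X,\lambda)\asymp \dfrac{e^{\langle\lambda,X^+\rangle}}{(1+\alpha_\lambda\alpha_{X^+})^{k}(1+\beta_\lambda\beta_{X^+})^{k+1}(1+\gamma_\lambda\gamma_{X^+})^{k+1}}$ if $\beta_\lambda\ge\alpha_\lambda$ and $\alpha_\lambda\alpha_{X^+}\ge\beta_\lambda\beta_{X^+}$; $E_k(X,\lambda)\asymp \dfrac{e^{\langle\lambda,X^+\rangle}}{(1+\alpha_\lambda\alpha_{X^+})^{k+1}(1+\beta_\lambda\beta_{X^+})^{k}(1+\gamma_\lambda\gamma_{X^+})^{k+1}}$ if $\beta_\lambda\ge\alpha_\lambda$ and $\alpha_\lambda\alpha_{X^+}\le\beta_\lambda\beta_{X^+}$.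 (v) If $x_3\ge x_2\ge x_1$: $E_k(X,\lambda)\asymp \dfrac{e^{\langle\lambda,X^+\rangle}}{(1+\alpha_\lambda\alpha_{X^+})^{k}(1+\beta_\lambda\beta_{X^+})^{k}(1+\gamma_\lambda\gamma_{X^+})^{k+1}}$.
   Context: $\mathfrak a=\{X=(x_1,x_2,x_3)\in\mathbb R^3: x_1+x_2+x_3=0\}$ with the standard inner product $\langle\cdot,\cdot\rangle$; root system $A_2$ with positive roots $\alpha=e_1-e_2$, $\beta=e_2-e_3$, $\gamma=\alpha+\beta=e_1-e_3$, Weyl group $S_3$ acting by permuting coordinates, $\sigma_\alpha$ the reflection in $\alpha$; $C^+=\{X\in\mathfrak a: x_1>x_2>x_3\}$. For constant multiplicity $k>0$, the Dunkl operators are $T_\xi f(X)=\partial_\xi f(X)+\sum_{\alpha>0}k\langle\alpha,\xi\rangle\frac{f(X)-f(\sigma_\alpha X)}{\langle\alpha,X\rangle}$, and the Dunkl kernel $E_k(X,Y)$ is the unique real-analytic solution in $X$ of $T_\xi E_k(\cdot,Y)=\langle\xi,Y\rangle E_k(\cdot,Y)$ ($\xi\in\mathfrak a$) with $E_k(0,Y)=1$. For $Z=(z_1,z_2,z_3)$ write $\alpha_Z=z_1-z_2$, $\beta_Z=z_2-z_3$, $\gamma_Z=z_1-z_3$. $X^+$ denotes the rearrangement of the entries of $X$ in decreasing order. $f\asymp g$ means $C^{-1}g\le f\le Cg$ for some constant $C>0$ uniform over the indicated domain. *)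

(* Defs.v *)
From Stdlib Require Import Reals Lra.
From Coquelicot Require Import Coquelicot.
Open Scope R_scope.

Definition vec := (R * R * R)%type.
Definition mk (x y z : R) : vec := (x, y, z).
Definition xc1 (X : vec) : R := fst (fst X).
Definition xc2 (X : vec) : R := snd (fst X).
Definition xc3 (X : vec) : R := snd X.

Definition inner (X Y : vec) : R := xc1 X * xc1 Y + xc2 X * xc2 Y + xc3 X * xc3 Y.
Definition vadd (X Y : vec) : vec := mk (xc1 X + xc1 Y) (xc2 X + xc2 Y) (xc3 X + xc3 Y).
Definition vscale (t : R) (X : vec) : vec := mk (t * xc1 X) (t * xc2 X) (t * xc3 X).

Definition in_a (X : vec) : Prop := xc1 X + xc2 X + xc3 X = 0.

Definition alpha_v : vec := mk 1 (-1) 0.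
Definition beta_v  : vec := mk 0 1 (-1).
Definition gamma_v : vec := mk 1 0 (-1).

Definition refl_alpha (X : vec) : vec := mk (xc2 X) (xc1 X) (xc3 X).
Definition refl_beta  (X : vec) : vec := mk (xc1 X) (xc3 X) (xc2 X).
Definition refl_gamma (X : vec) : vec := mk (xc3 X) (xc2 X) (xc1 X).

Definition alphaZ (Z : vec) : R := xc1 Z - xc2 Z.
Definition betaZ  (Z : vec) : R := xc2 Z - xc3 Z.
Definition gammaZ (Z : vec) : R := xc1 Z - xc3 Z.

Definition in_Cplus (L : vec) : Prop := in_a L /\ xc1 L > xc2 L /\ xc2 L > xc3 L.

Definition Xplus (X : vec) : vec :=
  let M := Rmax (xc1 X) (Rmax (xc2 X) (xc3 X)) in
  let m := Rmin (xc1 X) (Rmin (xc2 X) (xc3 X)) in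
  mk M (xc1 X + xc2 X + xc3 X - M - m) m.

(* reflection part of the Dunkl operator T_xi (note <alpha,X> = alphaZ X etc.) *)
Definition dunkl_refl_part (k : R) (f : vec -> R) (xi X : vec) : R :=
  k * inner alpha_v xi * (f X - f (refl_alpha X)) / alphaZ X
+ k * inner beta_v xi * (f X - f (refl_beta X)) / betaZ X
+ k * inner gamma_v xi * (f X - f (refl_gamma X)) / gammaZ X.

(* f is real-analytic on the plane a: near every point X0 of a, in the
   coordinates X0 + s*alpha + t*beta, f is given by an absolutely convergent
   double power series on a polydisc of radius r > 0. *)
Definition real_analytic_on_a (f : vec -> R) : Prop :=
  forall X0, in_a X0 ->
  exists (r : R) (c : nat -> nat -> R), 0 < r /\
    (forall i, ex_series (fun j => Rabs (c i j) * r ^ (i + j))) /\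
    ex_series (fun i => Series (fun j => Rabs (c i j) * r ^ (i + j))) /\
    (forall s t, Rabs s < r -> Rabs t < r ->
       f (vadd X0 (vadd (vscale s alpha_v) (vscale t beta_v)))
       = Series (fun i => Series (fun j => c i j * s ^ i * t ^ j))).

(* E is the Dunkl kernel E_k(X,Y) of A_2 with constant multiplicity k:
   for each Y in a, X |-> E X Y is real-analytic on a, equals 1 at X = 0 and
   satisfies T_xi E(.,Y) = <xi,Y> E(.,Y) for xi in a (imposed off the walls,
   where the difference quotients are defined; by analyticity/continuity
   this determines the equation everywhere). *)
Definition IsDunklKernel (k : R) (E : vec -> vec -> R) : Prop :=
  forall Y, in_a Y ->
    real_analytic_on_a (fun X => E X Y) /\
    E (mk 0 0 0) Y = 1 /\
    (forall X xi, in_a X -> in_a xi ->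
       alphaZ X <> 0 -> betaZ X <> 0 -> gammaZ X <> 0 ->
       is_derive (fun t => E (vadd X (vscale t xi)) Y) 0
         (inner xi Y * E X Y - dunkl_refl_part k (fun Z => E Z Y) xi X)).

Definition asymp (C f g : R) : Prop := / C * g <= f <= C * g.

Definition wt (L Z : vec) (a b c : R) : R :=
  exp (inner L Z) /
  (Rpower (1 + alphaZ L * alphaZ Z) a *
   Rpower (1 + betaZ L * betaZ Z) b *
   Rpower (1 + gammaZ L * gammaZ Z) c).

(* Main.v *)
Require Import Defs.
From Stdlib Require Import Reals Lra Psatz Lia.
From Coquelicot Require Import Coquelicot.
Open Scope R_scope.

(* Let [Y] be dominant. Along the ray [t Y] the six functions
   [g_w(t) = E(t wY, L) exp(- t <Y, L>)] solve a closed linear system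
   [g_w' = - d_w g_w + (k / t) sum_x (g_x - g_w)], where [x] runs over
   [s_alpha w, s_beta w, s_gamma w], [d_w = <Y - wY, L>] and [g_w(0) = 1]. With
   [u = alpha_L alpha_Y], [v = beta_L beta_Y], [A = alpha_L beta_Y],
   [B = beta_L alpha_Y] (so [A B = u v]) the rates are [0] for the identity,
   [u], [v], [u + v + A + B] for the reflections, [u + v + B], [u + v + A] for the
   rotations. The system is cooperative, hence the [g_w] are nonnegative. The ratios
   [r_w = g_w / g_1] satisfy Riccati equations, and scalar barriers show that
   [r_w] is of order [1 / (1 + d_w t)] for a reflection and
   [1 / ((1 + min(u, v) t) (1 + d_w t))] for a rotation. Finally [t (ln g_1)' / k] is
   [S - 3] with [S] the sum of the reflection ratios, and it remains to see that
   [S - sum_i 1 / (1 + u_i t)] has bounded integral against [dt / t], [u_i] being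
   the rates of the reflections. On a range of [t] where [n] of the [u_i t] are at
   most [1] and the other ones at least [1], the sum [sigma] of the [n] corresponding
   ratios satisfies [t sigma' = k (n^2 - sigma^2)] up to integrable terms, so the
   integral of [k (n - sigma) dt / t] is the variation of [ln (n + sigma)] up to a
   bounded error. The walls are reached by continuity. *)

(** The barriers give the ratios only up to constant factors, and a constant factor in [S] would
    change the power of [t] in [g_1]. Hence the integral of [k (n - sigma) / t] has to be computed
    through an almost exact derivative, and cannot be read off the pointwise bounds. The square
    [n^2] arises as [n] times one plus the number of rotations whose ratio has not yet decayed: two,
    one and none of them for [n = 3, 2, 1]. The case [n = 2] is the delicate one. There [A B = u v]
    gives [min(A, B) <= max(u, v)], so one rotation rate is at most [3 max(u, v)], while the other
    is at least half the largest reflection rate. For a surviving rotation, [(k / t) (1 - r)] has no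
    integrable pointwise bound from the barriers. Its own equation bounds it by a multiple of
    [r' + d], and [r'] integrates to at most 1. The case distinctions for the rotations come from
    comparing [u + v + A] and [u + v + B] either with [u + v] or with [u + v + A + B]. *)

(** * Calculus on the line and a comparison principle *)

Lemma is_derive_continuous (f : R -> R) (x l : R) : is_derive f x l -> continuous f x.
Proof. intros H; apply (@ex_derive_continuous R_AbsRing R_NormedModule); now exists l. Qed.

Lemma continuous_lt_locally (f : R -> R) (x c : R) :
  continuous f x -> f x < c -> exists d, 0 < d /\ forall y, Rabs (y - x) < d -> f y < c.
Proof.
  intros Hf Hc.
  destruct (Hf (fun y => y < c)) as [d Hd].
  - exact (open_lt c (f x) Hc).
  - exists d; split; [apply cond_pos|].
    intros y Hy; apply Hd, Hy.
Qed.

Lemma continuous_gt_locally (f : R -> R) (x c : R) :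
  continuous f x -> c < f x -> exists d, 0 < d /\ forall y, Rabs (y - x) < d -> c < f y.
Proof.
  intros Hf Hc.
  destruct (Hf (fun y => c < y)) as [d Hd].
  - exact (open_gt c (f x) Hc).
  - exists d; split; [apply cond_pos|].
    intros y Hy; apply Hd, Hy.
Qed.

Lemma nonneg_derive_le (f f' : R -> R) (a b : R) : a <= b ->
  (forall t, a <= t <= b -> is_derive f t (f' t)) ->
  (forall t, a <= t <= b -> 0 <= f' t) -> f a <= f b.
Proof.
  intros Hab Hd Hf.
  destruct (Req_dec a b) as [->|Hne]; [lra|].
  destruct (MVT_cor2 f f' a b) as [c [Hc Hc']]; [lra| |].
  - intros c Hc; apply is_derive_Reals; auto.
  - assert (0 <= f' c) by (apply Hf; lra).
    nra.
Qed.

(** After the last time [s] before [T] with [g >= 0], the function is negative, hence nondecreasing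
    up to [T]; but just after [s] continuity makes it larger than [g T < 0]. Differentiability is
    required only for positive times because the equations are singular at 0, and the sign of [g']
    only where [g < 0], so that each application may use that its bound is violated. *)
Lemma barrier (g g' : R -> R) (T : R) : 0 < T -> 0 <= g 0 -> continuous g 0 ->
  (forall t, 0 < t -> is_derive g t (g' t)) ->
  (forall t, 0 < t -> g t < 0 -> 0 <= g' t) -> 0 <= g T.
Proof.
  intros HT H0 Hc Hd Hneg.
  destruct (Rle_lt_dec 0 (g T)) as [|HgT]; [assumption|exfalso].
  destruct (completeness (fun s => 0 <= s <= T /\ 0 <= g s)) as [s [Hub Hlub]].
  - exists T; intros x [[_ Hx] _]; exact Hx.
  - exists 0; split; lra.
  - assert (Hs0 : 0 <= s) by (apply Hub; split; lra).
    assert (HsT : s <= T) by (apply Hlub; intros x [[_ Hx] _]; exact Hx).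
    assert (Hcs : continuous g s).
    { destruct (Req_dec s 0) as [->|]; [exact Hc|].
      apply (is_derive_continuous _ _ (g' s)), Hd; lra. }
    assert (Hgs : 0 <= g s).
    { destruct (Rle_lt_dec 0 (g s)) as [|Hlt]; [assumption|exfalso].
      destruct (continuous_lt_locally g s 0 Hcs Hlt) as [d [Hd0 Hd1]].
      assert (s <= s - d); [|lra].
      apply Hlub; intros x [Hx Hgx].
      assert (x <= s) by (apply Hub; split; assumption).
      destruct (Rle_lt_dec x (s - d)); [assumption|].
      assert (g x < 0) by (apply Hd1; apply Rabs_def1; lra). lra. }
    assert (Hlt : s < T) by (destruct (Req_dec s T); [subst; lra | lra]).
    destruct (continuous_gt_locally g s (g T) Hcs) as [d [Hd0 Hd1]]; [lra|].
    set (x := s + Rmin (d / 2) (T - s)).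
    assert (Hx : s < x <= T /\ x - s < d).
    { unfold x; generalize (Rmin_l (d / 2) (T - s)) (Rmin_r (d / 2) (T - s)).
      assert (0 < Rmin (d / 2) (T - s)) by (apply Rmin_glb_lt; lra). lra. }
    assert (Hgx : g T < g x) by (apply Hd1; apply Rabs_def1; lra).
    assert (g x <= g T); [|lra].
    apply (nonneg_derive_le g g'); [lra| |].
    + intros t Ht; apply Hd; lra.
    + intros t Ht; apply Hneg; [lra|].
      destruct (Rlt_le_dec (g t) 0); [assumption|].
      assert (t <= s) by (apply Hub; split; lra). lra.
Qed.

Lemma is_derive_eq (f : R -> R) (x l l' : R) : is_derive f x l -> l = l' -> is_derive f x l'.
Proof. now intros H <-. Qed.

Lemma is_derive_Rplus (f g : R -> R) (x l m : R) :
  is_derive f x l -> is_derive g x m -> is_derive (fun t => f t + g t) x (l + m).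
Proof. apply (@is_derive_plus R_AbsRing R_NormedModule). Qed.

Lemma is_derive_Ropp (f : R -> R) (x l : R) :
  is_derive f x l -> is_derive (fun t => - f t) x (- l).
Proof. apply (@is_derive_opp R_AbsRing R_NormedModule). Qed.

Lemma is_derive_Rminus (f g : R -> R) (x l m : R) :
  is_derive f x l -> is_derive g x m -> is_derive (fun t => f t - g t) x (l - m).
Proof. apply (@is_derive_minus R_AbsRing R_NormedModule). Qed.

Lemma is_derive_Rmult (f g : R -> R) (x l m : R) :
  is_derive f x l -> is_derive g x m ->
  is_derive (fun t => f t * g t) x (l * g x + f x * m).
Proof.
  intros Hf Hg; apply (is_derive_mult f g x l m Hf Hg); intros; apply Rmult_comm.
Qed.

Lemma continuous_Rplus (f g : R -> R) (x : R) :
  continuous f x -> continuous g x -> continuous (fun t => f t + g t) x.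
Proof. apply (@continuous_plus R_UniformSpace R_AbsRing R_NormedModule). Qed.

Lemma continuous_Ropp (f : R -> R) (x : R) :
  continuous f x -> continuous (fun t => - f t) x.
Proof. apply (@continuous_opp R_UniformSpace R_AbsRing R_NormedModule). Qed.

Lemma continuous_Rminus (f g : R -> R) (x : R) :
  continuous f x -> continuous g x -> continuous (fun t => f t - g t) x.
Proof. apply (@continuous_minus R_UniformSpace R_AbsRing R_NormedModule). Qed.

Lemma continuous_Rmult (f g : R -> R) (x : R) :
  continuous f x -> continuous g x -> continuous (fun t => f t * g t) x.
Proof. apply (@continuous_mult R_UniformSpace R_AbsRing). Qed.

(** * The linear system and the sign of its solutions *)

(** The square makes the negative part differentiable across 0: the first-order Taylor remainder is
    at most [h ^ 2] in every sign configuration. *)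
Lemma is_derive_Rmin0_sqr (x : R) :
  is_derive (fun y => Rmin y 0 ^ 2) x (2 * Rmin x 0).
Proof.
  apply is_derive_Reals; intros e He.
  exists (mkposreal e He); intros h Hh Hhe; simpl in Hhe.
  assert (Hq : Rabs (Rmin (x + h) 0 ^ 2 - Rmin x 0 ^ 2 - 2 * Rmin x 0 * h) <= h ^ 2).
  { unfold Rmin; destruct (Rle_dec (x + h) 0), (Rle_dec x 0);
      apply Rabs_le; nra. }
  replace ((Rmin (x + h) 0 ^ 2 - Rmin x 0 ^ 2) / h - 2 * Rmin x 0)
    with ((Rmin (x + h) 0 ^ 2 - Rmin x 0 ^ 2 - 2 * Rmin x 0 * h) / h) by (field; auto).
  unfold Rdiv; rewrite Rabs_mult, Rabs_inv.
  assert (Hp : 0 < Rabs h) by now apply Rabs_pos_lt.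
  apply Rmult_lt_reg_r with (Rabs h); [assumption|].
  rewrite Rmult_assoc, Rinv_l, Rmult_1_r by lra.
  apply Rle_lt_trans with (1 := Hq).
  rewrite <- (pow2_abs h). nra.
Qed.

(* [g0, ..., g5] stand for the points (y1,y2,y3), (y2,y1,y3), (y1,y3,y2), (y3,y2,y1),
   (y2,y3,y1), (y3,y1,y2): [g0, g4, g5] are even, [g1, g2, g3] odd, and each reflection
   exchanges the two classes. *)
Record dunkl_system (k u v A B : R) (g0 g1 g2 g3 g4 g5 : R -> R) : Prop := {
  ds_k : 0 < k; ds_u : 0 < u; ds_v : 0 < v; ds_A : 0 < A; ds_B : 0 < B;
  ds_AB : A * B = u * v;
  ds_init : g0 0 = 1 /\ g1 0 = 1 /\ g2 0 = 1 /\ g3 0 = 1 /\ g4 0 = 1 /\ g5 0 = 1;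
  ds_c0 : continuous g0 0; ds_c1 : continuous g1 0; ds_c2 : continuous g2 0;
  ds_c3 : continuous g3 0; ds_c4 : continuous g4 0; ds_c5 : continuous g5 0;
  ds_d0 : forall t, 0 < t -> is_derive g0 t (k / t * (g1 t + g2 t + g3 t - 3 * g0 t));
  ds_d1 : forall t, 0 < t ->
    is_derive g1 t (- u * g1 t + k / t * (g0 t + g4 t + g5 t - 3 * g1 t));
  ds_d2 : forall t, 0 < t ->
    is_derive g2 t (- v * g2 t + k / t * (g0 t + g4 t + g5 t - 3 * g2 t));
  ds_d3 : forall t, 0 < t ->
    is_derive g3 t (- (u + v + A + B) * g3 t + k / t * (g0 t + g4 t + g5 t - 3 * g3 t));
  ds_d4 : forall t, 0 < t ->
    is_derive g4 t (- (u + v + B) * g4 t + k / t * (g1 t + g2 t + g3 t - 3 * g4 t));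
  ds_d5 : forall t, 0 < t ->
    is_derive g5 t (- (u + v + A) * g5 t + k / t * (g1 t + g2 t + g3 t - 3 * g5 t)) }.

Definition negsq (g : R -> R) (t : R) : R := Rmin (g t) 0 ^ 2.

Lemma is_derive_negsq (g : R -> R) (t l : R) :
  is_derive g t l -> is_derive (negsq g) t (2 * Rmin (g t) 0 * l).
Proof.
  intros H; unfold negsq.
  apply (is_derive_eq _ _ (scal l (2 * Rmin (g t) 0))).
  - apply (is_derive_comp (fun y => Rmin y 0 ^ 2) g); [apply is_derive_Rmin0_sqr | exact H].
  - unfold scal; simpl; unfold mult; simpl; ring.
Qed.

Lemma continuous_negsq (g : R -> R) (t : R) : continuous g t -> continuous (negsq g) t.
Proof.
  intros H; unfold negsq.
  apply (continuous_comp g (fun y => Rmin y 0 ^ 2)); [exact H|].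
  apply (is_derive_continuous _ _ _ (is_derive_Rmin0_sqr (g t))).
Qed.

(** Since [Rmin x 0 <= 0], replacing a neighbour by its smaller truncation can only increase the
    product. This is where the nonnegative sign of the couplings enters. *)
Lemma Rmin0_mul_diff (x y z w : R) :
  Rmin x 0 * (y + z + w - 3 * x)
  <= Rmin x 0 * Rmin y 0 + Rmin x 0 * Rmin z 0 + Rmin x 0 * Rmin w 0 - 3 * Rmin x 0 ^ 2.
Proof.
  assert (H : forall a b, Rmin a 0 * b <= Rmin a 0 * Rmin b 0).
  { intros a b; generalize (Rmin_r a 0) (Rmin_l b 0); nra. }
  assert (H' : Rmin x 0 * x = Rmin x 0 ^ 2).
  { unfold Rmin; destruct (Rle_dec x 0); ring. }
  generalize (H x y) (H x z) (H x w); nra.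
Qed.

Lemma Rmin0_damping (a x : R) : 0 <= a -> Rmin x 0 * (- a * x) <= 0.
Proof.
  intros Ha; unfold Rmin; destruct (Rle_dec x 0); [|lra].
  nra.
Qed.

Section System.

Variables (k u v A B : R) (g0 g1 g2 g3 g4 g5 : R -> R).
Hypothesis sys : dunkl_system k u v A B g0 g1 g2 g3 g4 g5.


(* The energy [sum_w min(g_w, 0)^2] is nonincreasing because the coupling is cooperative. *)
Lemma dunkl_system_nonneg (t : R) : 0 < t ->
  0 <= g0 t /\ 0 <= g1 t /\ 0 <= g2 t /\ 0 <= g3 t /\ 0 <= g4 t /\ 0 <= g5 t.
Proof.
  intros Ht.
  pose proof sys as [pk pu pv pA pB _ (i0 & i1 & i2 & i3 & i4 & i5)
    c0 c1 c2 c3 c4 c5 d0 d1 d2 d3 d4 d5].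
  pose (N := fun s => - (negsq g0 s + negsq g1 s + negsq g2 s
                       + negsq g3 s + negsq g4 s + negsq g5 s)).
  assert (HN : 0 <= N t).
  { refine (barrier N (fun s => - (
      2 * Rmin (g0 s) 0 * (k / s * (g1 s + g2 s + g3 s - 3 * g0 s))
    + 2 * Rmin (g1 s) 0 * (- u * g1 s + k / s * (g0 s + g4 s + g5 s - 3 * g1 s))
    + 2 * Rmin (g2 s) 0 * (- v * g2 s + k / s * (g0 s + g4 s + g5 s - 3 * g2 s))
    + 2 * Rmin (g3 s) 0 * (- (u + v + A + B) * g3 s + k / s * (g0 s + g4 s + g5 s - 3 * g3 s))
    + 2 * Rmin (g4 s) 0 * (- (u + v + B) * g4 s + k / s * (g1 s + g2 s + g3 s - 3 * g4 s))
    + 2 * Rmin (g5 s) 0 * (- (u + v + A) * g5 s + k / s * (g1 s + g2 s + g3 s - 3 * g5 s)))) t Ht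
      _ _ _ _).
    - unfold N, negsq; rewrite i0, i1, i2, i3, i4, i5, Rmin_right by lra; lra.
    - unfold N; apply continuous_Ropp.
      do 5 (apply continuous_Rplus; [|now apply continuous_negsq]).
      now apply continuous_negsq.
    - intros s Hs; unfold N; apply is_derive_Ropp.
      repeat apply is_derive_Rplus;
        apply is_derive_negsq; auto.
    - intros s Hs _.
      assert (Hks : 0 < k / s) by (apply Rdiv_lt_0_compat; auto).
      generalize (Rmin0_mul_diff (g0 s) (g1 s) (g2 s) (g3 s))
        (Rmin0_mul_diff (g1 s) (g0 s) (g4 s) (g5 s))
        (Rmin0_mul_diff (g2 s) (g0 s) (g4 s) (g5 s))
        (Rmin0_mul_diff (g3 s) (g0 s) (g4 s) (g5 s))
        (Rmin0_mul_diff (g4 s) (g1 s) (g2 s) (g3 s))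
        (Rmin0_mul_diff (g5 s) (g1 s) (g2 s) (g3 s))
        (Rmin0_damping u (g1 s) ltac:(lra)) (Rmin0_damping v (g2 s) ltac:(lra))
        (Rmin0_damping (u + v + A + B) (g3 s) ltac:(lra))
        (Rmin0_damping (u + v + B) (g4 s) ltac:(lra))
        (Rmin0_damping (u + v + A) (g5 s) ltac:(lra)).
      set (n0 := Rmin (g0 s) 0); set (n1 := Rmin (g1 s) 0); set (n2 := Rmin (g2 s) 0);
      set (n3 := Rmin (g3 s) 0); set (n4 := Rmin (g4 s) 0); set (n5 := Rmin (g5 s) 0).
      intros e0 e1 e2 e3 e4 e5 b1 b2 b3 b4 b5.
      set (m0 := n0 * (g1 s + g2 s + g3 s - 3 * g0 s)) in *.
      set (m1 := n1 * (g0 s + g4 s + g5 s - 3 * g1 s)) in *.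
      set (m2 := n2 * (g0 s + g4 s + g5 s - 3 * g2 s)) in *.
      set (m3 := n3 * (g0 s + g4 s + g5 s - 3 * g3 s)) in *.
      set (m4 := n4 * (g1 s + g2 s + g3 s - 3 * g4 s)) in *.
      set (m5 := n5 * (g1 s + g2 s + g3 s - 3 * g5 s)) in *.
      (* The coupling graph is complete bipartite between [{0, 4, 5}] and [{1, 2, 3}], of degree 3,
         so the sum is at most minus the sum of [(n_i - n_j)^2] over its nine edges. *)
      assert (Hm : m0 + m1 + m2 + m3 + m4 + m5 <= 0).
      { clearbody m0 m1 m2 m3 m4 m5.
        assert (0 <= (n0-n1)^2+(n0-n2)^2+(n0-n3)^2+(n4-n1)^2+(n4-n2)^2+(n4-n3)^2
                     +(n5-n1)^2+(n5-n2)^2+(n5-n3)^2).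
        { repeat apply Rplus_le_le_0_compat; apply pow2_ge_0. }
        lra. }
      replace (- _) with (2 * (- (k / s * (m0 + m1 + m2 + m3 + m4 + m5))
        - n1 * (- u * g1 s) - n2 * (- v * g2 s) - n3 * (- (u + v + A + B) * g3 s)
        - n4 * (- (u + v + B) * g4 s) - n5 * (- (u + v + A) * g5 s)))
        by (unfold m0, m1, m2, m3, m4, m5; ring).
      assert (k / s * (m0 + m1 + m2 + m3 + m4 + m5) <= 0) by nra.
      lra. }
  unfold N, negsq in HN.
  assert (Hz : forall x, Rmin x 0 ^ 2 <= 0 -> 0 <= x).
  { intros x; unfold Rmin; destruct (Rle_dec x 0); nra. }
  assert (q0 := pow2_ge_0 (Rmin (g0 t) 0)). assert (q1 := pow2_ge_0 (Rmin (g1 t) 0)).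
  assert (q2 := pow2_ge_0 (Rmin (g2 t) 0)). assert (q3 := pow2_ge_0 (Rmin (g3 t) 0)).
  assert (q4 := pow2_ge_0 (Rmin (g4 t) 0)). assert (q5 := pow2_ge_0 (Rmin (g5 t) 0)).
  repeat split; apply Hz; lra.
Qed.

(** The integrating factor [t^(3 k)] removes the term [- 3 k g0 / t], so [t^(3 k) g0] is
    nondecreasing by nonnegativity of the other components, and it is positive for small [t] because
    [g0 0 = 1]. *)
Lemma dunkl_system_pos (t : R) : 0 <= t -> 0 < g0 t.
Proof.
  intros Ht0.
  pose proof sys as [pk pu pv pA pB _ (i0 & _) c0 _ _ _ _ _ d0 _ _ _ _ _].
  destruct (Req_dec t 0) as [->|Hne]; [lra|].
  assert (Ht : 0 < t) by lra.
  destruct (continuous_gt_locally g0 0 0 c0) as [d [Hd Hd']]; [lra|].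
  set (s := Rmin t (d / 2)).
  assert (Hs : 0 < s <= t /\ s < d).
  { unfold s; generalize (Rmin_l t (d / 2)) (Rmin_r t (d / 2)).
    assert (0 < Rmin t (d / 2)) by (apply Rmin_glb_lt; lra). lra. }
  assert (Hgs : 0 < g0 s) by (apply Hd'; apply Rabs_def1; lra).
  assert (Hmon : g0 s * exp (3 * k * ln s) <= g0 t * exp (3 * k * ln t)).
  { refine (nonneg_derive_le (fun x => g0 x * exp (3 * k * ln x))
      (fun x => k / x * (g1 x + g2 x + g3 x) * exp (3 * k * ln x)) s t _ _ _); [lra| |].
    - intros x Hx.
      eapply is_derive_eq.
      + apply is_derive_Rmult; [apply d0; lra|].
        instantiate (1 := 3 * k / x * exp (3 * k * ln x)).
        auto_derive; [lra|field; lra].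
      + simpl; field; lra.
    - intros x Hx.
      destruct (dunkl_system_nonneg x) as (_ & h1 & h2 & h3 & _); [lra|].
      apply Rmult_le_pos; [apply Rmult_le_pos|]; [|lra|left; apply exp_pos].
      apply Rdiv_le_0_compat; lra. }
  assert (h1 := exp_pos (3 * k * ln s)). assert (h2 := exp_pos (3 * k * ln t)).
  destruct (Rlt_le_dec 0 (g0 t)); [assumption|nra].
Qed.

End System.

(** * Barriers for the Riccati equations of the ratios *)

Lemma is_derive_hyperbola (C a t : R) : 0 <= a -> 0 < t ->
  is_derive (fun s => C / (1 + a * s)) t (- (C * a / (1 + a * t) ^ 2)).
Proof.
  intros Ha Ht; assert (0 <= a * t) by nra.
  auto_derive; [lra|field; lra].
Qed.

Lemma continuous_hyperbola (C a : R) : continuous (fun s => C / (1 + a * s)) 0.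
Proof.
  apply (@ex_derive_continuous R_AbsRing R_NormedModule).
  auto_derive; lra.
Qed.

(** The hyperbola is a supersolution. With [y = a t] and [z = / (1 + y)], the inequality multiplied
    by [t] no longer involves [a], so that the constant depends on [k] only. Where [r] exceeds the
    hyperbola, [S >= r] bounds the coupling term by [k (3 - (C z)^2)], which settles small [y]; for
    large [y] the damping, less the slope of the hyperbola, leaves [C (y z)^2]. *)
Lemma odd_upper (k a : R) (r P S : R -> R) (T : R) : 0 < k -> 0 <= a -> 0 < T ->
  r 0 = 1 -> continuous r 0 ->
  (forall t, 0 < t -> is_derive r t (- a * r t + k / t * (P t - r t * S t))) ->
  (forall t, 0 < t -> P t <= 3 /\ 0 <= r t <= S t) ->
  r T <= (6 * k + 3) / (1 + a * T).
Proof.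
  intros Hk Ha HT H0 Hc Hd Hb.
  set (C := 6 * k + 3).
  enough (0 <= C / (1 + a * T) - r T) by lra.
  refine (barrier (fun t => C / (1 + a * t) - r t) (fun t => - (C * a / (1 + a * t) ^ 2)
    - (- a * r t + k / t * (P t - r t * S t))) T HT _ _ _ _).
  - simpl; rewrite H0, Rmult_0_r. unfold C; lra.
  - apply continuous_Rminus; [apply continuous_hyperbola|exact Hc].
  - intros t Ht; apply is_derive_Rminus; [now apply is_derive_hyperbola|auto].
  - intros t Ht Hneg. destruct (Hb t Ht) as [HP [Hr HS]].
    assert (Hy : 0 <= a * t) by nra. set (y := a * t) in *.
    set (z := / (1 + y)).
    assert (Hz : 0 < z) by (apply Rinv_0_lt_compat; lra).
    assert (Hz1 : z * (1 + y) = 1) by (apply Rinv_l; lra).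
    replace (C / (1 + y)) with (C * z) in Hneg by reflexivity.
    replace (- (C * a / (1 + y) ^ 2) - (- a * r t + k / t * (P t - r t * S t)))
      with (/ t * (y * r t - C * y * z ^ 2 - k * (P t - r t * S t)))
      by (unfold z, y; field; unfold y in Hy; lra).
    apply Rmult_le_pos; [left; now apply Rinv_0_lt_compat|].
    assert (h1 : (C * z) ^ 2 <= r t * S t).
    { assert (0 < C * z) by (apply Rmult_lt_0_compat; unfold C; lra). nra. }
    assert (h2 : y * (C * z) <= y * r t) by (apply Rmult_le_compat_l; lra).
    assert (h3 : k * (P t - r t * S t) <= k * (3 - (C * z) ^ 2)).
    { apply Rmult_le_compat_l; lra. }
    assert (h4 : y * (C * z) - C * y * z ^ 2 = C * (y * z) ^ 2).
    { replace (y * (C * z)) with (C * y * z * (z * (1 + y))) by (rewrite Hz1; ring). ring. }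
    (* Since [z + y z = 1], the two squares cannot both be small. The source [3 k] is then paid for
       by [C >= 6 k] on one of them and [C^2 >= 6] on the other, whence the value of [C]. *)
    assert (h5 : 1 <= 2 * z ^ 2 + 2 * (y * z) ^ 2).
    { replace 1 with ((z * (1 + y)) ^ 2) by (rewrite Hz1; ring).
      assert (0 <= (z - y * z) ^ 2) by apply pow2_ge_0. lra. }
    assert (h6 : 3 * k <= C * (y * z) ^ 2 + k * (C * z) ^ 2).
    { assert (6 * k <= C) by (unfold C; lra). assert (6 <= C ^ 2) by (unfold C; nra).
      assert (0 <= (y * z) ^ 2) by apply pow2_ge_0. assert (0 <= z ^ 2) by apply pow2_ge_0.
      assert (6 * k * (y * z) ^ 2 <= C * (y * z) ^ 2) by (apply Rmult_le_compat_r; lra).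
      assert (k * (6 * z ^ 2) <= k * (C * z) ^ 2).
      { apply Rmult_le_compat_l; [lra|]. rewrite Rpow_mult_distr.
        apply Rmult_le_compat_r; lra. }
      assert (k * 1 <= k * (2 * z ^ 2 + 2 * (y * z) ^ 2)) by (apply Rmult_le_compat_l; lra).
      lra. }
    lra.
Qed.

(** Below the hyperbola the coupling term is at least [k - 3 k c] and the damping at most [c]; the
    choice [c (1 + 3 k) = k] balances the two exactly. *)
Lemma odd_lower (k a : R) (r P S : R -> R) (T : R) : 0 < k -> 0 <= a -> 0 < T ->
  r 0 = 1 -> continuous r 0 ->
  (forall t, 0 < t -> is_derive r t (- a * r t + k / t * (P t - r t * S t))) ->
  (forall t, 0 < t -> 1 <= P t /\ 0 <= r t /\ S t <= 3) ->
  k / (1 + 3 * k) / (1 + a * T) <= r T.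
Proof.
  intros Hk Ha HT H0 Hc Hd Hb.
  set (c := k / (1 + 3 * k)).
  assert (Hc0 : 0 < c) by (apply Rdiv_lt_0_compat; lra).
  assert (Hc1 : c * (1 + 3 * k) = k) by (unfold c; field; lra).
  enough (0 <= r T - c / (1 + a * T)) by lra.
  refine (barrier (fun t => r t - c / (1 + a * t)) (fun t =>
    (- a * r t + k / t * (P t - r t * S t)) - - (c * a / (1 + a * t) ^ 2)) T HT _ _ _ _).
  - simpl; rewrite H0, Rmult_0_r. unfold Rdiv; rewrite Rplus_0_r, Rinv_1. nra.
  - apply continuous_Rminus; [exact Hc|apply continuous_hyperbola].
  - intros t Ht; apply is_derive_Rminus; [auto|now apply is_derive_hyperbola].
  - intros t Ht Hneg. destruct (Hb t Ht) as [HP [Hr HS]].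
    assert (Hy : 0 <= a * t) by nra. set (y := a * t) in *.
    set (z := / (1 + y)).
    assert (Hz : 0 < z) by (apply Rinv_0_lt_compat; lra).
    assert (Hz1 : z * (1 + y) = 1) by (apply Rinv_l; lra).
    replace (c / (1 + y)) with (c * z) in Hneg by reflexivity.
    replace (- a * r t + k / t * (P t - r t * S t) - - (c * a / (1 + y) ^ 2))
      with (/ t * (- y * r t + k * (P t - r t * S t) + c * y * z ^ 2))
      by (unfold z, y; field; unfold y in Hy; lra).
    apply Rmult_le_pos; [left; now apply Rinv_0_lt_compat|].
    assert (h1 : r t * S t <= 3 * (c * z)) by nra.
    assert (h2 : y * r t <= y * (c * z)) by (apply Rmult_le_compat_l; lra).
    assert (h3 : k * (1 - 3 * (c * z)) <= k * (P t - r t * S t)).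
    { apply Rmult_le_compat_l; lra. }
    assert (0 <= y * z) by nra. assert (z <= 1) by nra. assert (y * z <= 1) by nra.
    assert (h4 : c * (y * z) <= c) by nra.
    assert (h5 : k * (c * z) <= k * c) by (apply Rmult_le_compat_l; nra).
    assert (h6 : 0 <= c * y * z ^ 2).
    { replace (c * y * z ^ 2) with (c * ((y * z) * z)) by ring.
      apply Rmult_le_pos; [lra|]. apply Rmult_le_pos; lra. }
    nra.
Qed.

Lemma even_le_1 (k d : R) (r S : R -> R) (T : R) : 0 < k -> 0 <= d -> 0 < T ->
  r 0 = 1 -> continuous r 0 ->
  (forall t, 0 < t -> is_derive r t (- d * r t + k / t * (S t * (1 - r t)))) ->
  (forall t, 0 < t -> 0 <= S t) -> r T <= 1.
Proof.
  intros Hk Hd0 HT H0 Hc Hd Hb.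
  enough (0 <= 1 - r T) by lra.
  refine (barrier (fun t => 1 - r t) (fun t =>
    0 - (- d * r t + k / t * (S t * (1 - r t)))) T HT _ _ _ _).
  - simpl; lra.
  - apply continuous_Rminus; [apply continuous_const|exact Hc].
  - intros t Ht; apply is_derive_Rminus; [apply (@is_derive_const R_AbsRing R_NormedModule)|auto].
  - intros t Ht Hneg. specialize (Hb t Ht).
    assert (0 < k / t) by now apply Rdiv_lt_0_compat.
    assert (S t * (1 - r t) <= 0) by nra.
    assert (k / t * (S t * (1 - r t)) <= 0) by nra.
    nra.
Qed.

Lemma is_derive_hyperbola2 (C b d t : R) : 0 <= b -> 0 <= d -> 0 < t ->
  is_derive (fun s => C / ((1 + b * s) * (1 + d * s))) t
    (- (C / ((1 + b * t) * (1 + d * t)) * (b / (1 + b * t) + d / (1 + d * t)))).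
Proof.
  intros Hb Hd Ht; assert (0 <= b * t) by nra; assert (0 <= d * t) by nra.
  auto_derive; [|field; lra].
  assert (0 < (1 + b * t) * (1 + d * t)) by (apply Rmult_lt_0_compat; lra). lra.
Qed.

Lemma continuous_hyperbola2 (C b d : R) :
  continuous (fun s => C / ((1 + b * s) * (1 + d * s))) 0.
Proof.
  apply (@ex_derive_continuous R_AbsRing R_NormedModule).
  auto_derive; lra.
Qed.

(** For large [t] the ratio is slaved to its source, [d r] being about [k S / t]; this explains the
    two factors of the barrier. The summand 25 makes the bound trivial, by [r <= 1], as long as
    [d t <= 4]; the summand [4 k C1] dominates the source beyond that. *)
Lemma even_upper (k b d C1 : R) (r S : R -> R) (T : R) :
  0 < k -> 0 <= b <= d -> 0 < C1 -> 0 < T ->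
  r 0 = 1 -> continuous r 0 ->
  (forall t, 0 < t -> is_derive r t (- d * r t + k / t * (S t * (1 - r t)))) ->
  (forall t, 0 < t -> 0 <= r t /\ 0 <= S t <= C1 / (1 + b * t)) ->
  r T <= (25 + 4 * k * C1) / ((1 + b * T) * (1 + d * T)).
Proof.
  intros Hk Hbd HC1 HT H0 Hc Hd Hb.
  assert (Hr1 : forall t, 0 < t -> r t <= 1).
  { intros t Ht; apply (even_le_1 k d r S t); try assumption; try lra; apply Hb. }
  set (C := 25 + 4 * k * C1).
  enough (0 <= C / ((1 + b * T) * (1 + d * T)) - r T) by lra.
  refine (barrier (fun t => C / ((1 + b * t) * (1 + d * t)) - r t) (fun t =>
    - (C / ((1 + b * t) * (1 + d * t)) * (b / (1 + b * t) + d / (1 + d * t)))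
    - (- d * r t + k / t * (S t * (1 - r t)))) T HT _ _ _ _).
  - simpl; rewrite H0, !Rmult_0_r, Rplus_0_r, Rmult_1_r. unfold C; nra.
  - apply continuous_Rminus; [apply continuous_hyperbola2|exact Hc].
  - intros t Ht; apply is_derive_Rminus; [apply is_derive_hyperbola2; lra|auto].
  - intros t Ht Hneg. destruct (Hb t Ht) as [Hr [HS HSb]]. specialize (Hr1 t Ht).
    assert (Hy : 0 <= b * t) by nra. assert (Hyz : b * t <= d * t) by nra.
    assert (HC : 25 <= C /\ 4 * k * C1 <= C).
    { unfold C; assert (0 < k * C1) by nra; lra. }
    set (y := b * t) in *. set (z := d * t) in *.
    set (f := / ((1 + y) * (1 + z))).
    assert (Hp : 0 < (1 + y) * (1 + z)) by (apply Rmult_lt_0_compat; lra).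
    assert (Hf : 0 < f) by now apply Rinv_0_lt_compat.
    assert (Hf1 : f * (1 + z) = / (1 + y)) by (unfold f; field; lra).
    assert (Hi : 0 < / (1 + y)) by (apply Rinv_0_lt_compat; lra).
    assert (Hff : f * ((1 + y) * (1 + z)) = 1) by (apply Rinv_l; lra).
    replace (C / ((1 + y) * (1 + z))) with (C * f) in * by reflexivity.
    assert (Hz4 : 4 < z).
    { destruct (Rlt_le_dec 4 z); [assumption|exfalso].
      assert ((1 + y) * (1 + z) <= 25) by nra. nra. }
    replace (- (C * f * (b / (1 + y) + d / (1 + z))) - (- d * r t + k / t * (S t * (1 - r t))))
      with (/ t * (z * r t - C * f * (y * / (1 + y) + z * / (1 + z)) - k * (S t * (1 - r t))))
      by (unfold y, z; field; unfold y, z in *; lra).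
    apply Rmult_le_pos; [left; now apply Rinv_0_lt_compat|].
    assert (h1 : S t * (1 - r t) <= C1 * / (1 + y)).
    { apply Rle_trans with (S t); [nra|exact HSb]. }
    assert (h2 : y * / (1 + y) + z * / (1 + z) <= 2).
    { assert (y * / (1 + y) <= 1) by (apply Rle_div_l; lra).
      assert (z * / (1 + z) <= 1) by (apply Rle_div_l; lra). lra. }
    assert (HCf : 0 < C * f) by nra.
    assert (h3 : C * f * (y * / (1 + y) + z * / (1 + z)) <= C * f * 2)
      by (apply Rmult_le_compat_l; lra).
    assert (h4 : z * (C * f) <= z * r t) by (apply Rmult_le_compat_l; lra).
    (* For [z >= 4] one has [z - 2 >= 2 / 5 * (1 + z)]: the damping [z], diminished by the
       logarithmic slope of the barrier (at most 2), keeps a fixed proportion of [1 + z]. *)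
    assert (h5 : 2 / 5 * (C * / (1 + y)) <= C * f * (z - 2)).
    { rewrite <- Hf1. nra. }
    assert (h6 : k * (S t * (1 - r t)) <= k * (C1 * / (1 + y))) by (apply Rmult_le_compat_l; lra).
    assert (h7 : 4 * k * C1 * / (1 + y) <= C * / (1 + y)) by (apply Rmult_le_compat_r; lra).
    assert (0 < k * C1 * / (1 + y)) by (apply Rmult_lt_0_compat; nra).
    lra.
Qed.

(** Below the barrier, [c <= 1 / 2] keeps [1 - r >= 1 / 2], so that at least half of the source
    acts; [c <= k * c1 / 2] makes this half outweigh the damping. *)
Lemma even_lower (k b d c1 c : R) (r S : R -> R) (T : R) :
  0 < k -> 0 <= b <= d -> 0 < c1 -> 0 < T ->
  0 < c -> c <= 1 / 2 -> c <= k * c1 / 2 ->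
  r 0 = 1 -> continuous r 0 ->
  (forall t, 0 < t -> is_derive r t (- d * r t + k / t * (S t * (1 - r t)))) ->
  (forall t, 0 < t -> 0 <= r t /\ c1 / (1 + b * t) <= S t) ->
  c / ((1 + b * T) * (1 + d * T)) <= r T.
Proof.
  intros Hk Hbd Hc1 HT Hc0 Hc2 Hc3 H0 Hc Hd Hb.
  enough (0 <= r T - c / ((1 + b * T) * (1 + d * T))) by lra.
  refine (barrier (fun t => r t - c / ((1 + b * t) * (1 + d * t))) (fun t =>
    (- d * r t + k / t * (S t * (1 - r t))) -
    - (c / ((1 + b * t) * (1 + d * t)) * (b / (1 + b * t) + d / (1 + d * t)))) T HT _ _ _ _).
  - simpl; rewrite H0, !Rmult_0_r, Rplus_0_r, Rmult_1_r. lra.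
  - apply continuous_Rminus; [exact Hc|apply continuous_hyperbola2].
  - intros t Ht; apply is_derive_Rminus; [auto|apply is_derive_hyperbola2; lra].
  - intros t Ht Hneg. destruct (Hb t Ht) as [Hr HS].
    assert (Hy : 0 <= b * t) by nra. assert (Hyz : b * t <= d * t) by nra.
    set (y := b * t) in *. set (z := d * t) in *.
    set (f := / ((1 + y) * (1 + z))).
    assert (Hp : 1 <= (1 + y) * (1 + z)) by nra.
    assert (Hf : 0 < f) by (apply Rinv_0_lt_compat; lra).
    assert (Hf1 : f * (1 + z) = / (1 + y)) by (unfold f; field; lra).
    assert (Hi : 0 < / (1 + y)) by (apply Rinv_0_lt_compat; lra).
    assert (Hff : f * ((1 + y) * (1 + z)) = 1) by (apply Rinv_l; lra).
    replace (c / ((1 + y) * (1 + z))) with (c * f) in * by reflexivity.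
    replace (c1 / (1 + y)) with (c1 * / (1 + y)) in * by reflexivity.
    replace (- d * r t + k / t * (S t * (1 - r t)) - - (c * f * (b / (1 + y) + d / (1 + z))))
      with (/ t * (k * (S t * (1 - r t)) - z * r t + c * f * (y * / (1 + y) + z * / (1 + z))))
      by (unfold y, z; field; unfold y, z in *; lra).
    apply Rmult_le_pos; [left; now apply Rinv_0_lt_compat|].
    assert (f <= 1) by nra.
    assert (Hr2 : r t <= 1 / 2) by nra.
    assert (h1 : c1 * / (1 + y) * (1 / 2) <= S t * (1 - r t)).
    { apply Rmult_le_compat; try lra. apply Rmult_le_pos; lra. }
    assert (h2 : 0 <= y * / (1 + y) + z * / (1 + z)).
    { apply Rplus_le_le_0_compat; apply Rdiv_le_0_compat; lra. }
    assert (h3 : 0 <= c * f * (y * / (1 + y) + z * / (1 + z))).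
    { apply Rmult_le_pos; [apply Rmult_le_pos|]; lra. }
    assert (h4 : z * r t <= z * (c * f)) by (apply Rmult_le_compat_l; lra).
    assert (h5 : z * (c * f) <= c * / (1 + y)) by (rewrite <- Hf1; nra).
    assert (h6 : k * (c1 * / (1 + y) * (1 / 2)) <= k * (S t * (1 - r t)))
      by (apply Rmult_le_compat_l; lra).
    assert (h7 : c * / (1 + y) <= k * c1 / 2 * / (1 + y)) by (apply Rmult_le_compat_r; lra).
    lra.
Qed.

(** * The ratios to the identity component: symmetries and two-sided bounds *)

Record ratio_system (k u v A B : R) (g r1 r2 r3 r4 r5 : R -> R) : Prop := {
  rs_k : 0 < k; rs_u : 0 < u; rs_v : 0 < v; rs_A : 0 < A; rs_B : 0 < B;
  rs_AB : A * B = u * v;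
  rs_g0 : g 0 = 1; rs_gc : continuous g 0;
  rs_gpos : forall t, 0 < t -> 0 < g t;
  rs_gd : forall t, 0 < t -> is_derive g t (k / t * (r1 t + r2 t + r3 t - 3) * g t);
  rs_init : r1 0 = 1 /\ r2 0 = 1 /\ r3 0 = 1 /\ r4 0 = 1 /\ r5 0 = 1;
  rs_c1 : continuous r1 0; rs_c2 : continuous r2 0; rs_c3 : continuous r3 0;
  rs_c4 : continuous r4 0; rs_c5 : continuous r5 0;
  rs_pos : forall t, 0 < t ->
    0 <= r1 t /\ 0 <= r2 t /\ 0 <= r3 t /\ 0 <= r4 t /\ 0 <= r5 t;
  rs_d1 : forall t, 0 < t -> is_derive r1 t
    (- u * r1 t + k / t * (1 + r4 t + r5 t - r1 t * (r1 t + r2 t + r3 t)));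
  rs_d2 : forall t, 0 < t -> is_derive r2 t
    (- v * r2 t + k / t * (1 + r4 t + r5 t - r2 t * (r1 t + r2 t + r3 t)));
  rs_d3 : forall t, 0 < t -> is_derive r3 t
    (- (u + v + A + B) * r3 t + k / t * (1 + r4 t + r5 t - r3 t * (r1 t + r2 t + r3 t)));
  rs_d4 : forall t, 0 < t -> is_derive r4 t
    (- (u + v + B) * r4 t + k / t * ((r1 t + r2 t + r3 t) * (1 - r4 t)));
  rs_d5 : forall t, 0 < t -> is_derive r5 t
    (- (u + v + A) * r5 t + k / t * ((r1 t + r2 t + r3 t) * (1 - r5 t))) }.

Lemma is_derive_Rdiv (f g : R -> R) (x l m : R) : g x <> 0 ->
  is_derive f x l -> is_derive g x m ->
  is_derive (fun t => f t / g t) x (l / g x - f x / g x * (m / g x)).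
Proof.
  intros Hg Hf Hm.
  apply (is_derive_eq _ _ _ _ (is_derive_div f g x l m Hf Hm Hg)); field; auto.
Qed.

Lemma continuous_Rdiv (f g : R -> R) (x : R) : g x <> 0 ->
  continuous f x -> continuous g x -> continuous (fun t => f t / g t) x.
Proof.
  intros Hg Hf Hc; unfold Rdiv; apply continuous_Rmult; [exact Hf|].
  apply (continuous_comp g Rinv); [exact Hc|].
  now apply continuous_Rinv.
Qed.

Lemma dunkl_ratio_system (k u v A B : R) (g0 g1 g2 g3 g4 g5 : R -> R) :
  dunkl_system k u v A B g0 g1 g2 g3 g4 g5 ->
  ratio_system k u v A B g0 (fun t => g1 t / g0 t) (fun t => g2 t / g0 t)
    (fun t => g3 t / g0 t) (fun t => g4 t / g0 t) (fun t => g5 t / g0 t).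
Proof.
  intros sys.
  assert (Hp : forall t, 0 <= t -> 0 < g0 t).
  { intros t Ht; exact (dunkl_system_pos _ _ _ _ _ _ _ _ _ _ _ sys t Ht). }
  assert (Hn := dunkl_system_nonneg _ _ _ _ _ _ _ _ _ _ _ sys).
  destruct sys as [pk pu pv pA pB pAB (i0 & i1 & i2 & i3 & i4 & i5)
    c0 c1 c2 c3 c4 c5 d0 d1 d2 d3 d4 d5].
  assert (Hq : forall t, 0 < t -> g0 t <> 0) by (intros t Ht; generalize (Hp t); lra).
  constructor; try assumption.
  - intros t Ht; apply Hp; lra.
  - intros t Ht; eapply is_derive_eq; [now apply d0|].
    simpl; field; split; [now apply Hq|lra].
  - rewrite i0, i1, i2, i3, i4, i5; repeat split; lra.
  - apply continuous_Rdiv; [lra|assumption..].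
  - apply continuous_Rdiv; [lra|assumption..].
  - apply continuous_Rdiv; [lra|assumption..].
  - apply continuous_Rdiv; [lra|assumption..].
  - apply continuous_Rdiv; [lra|assumption..].
  - intros t Ht; destruct (Hn t Ht) as (h0 & h1 & h2 & h3 & h4 & h5).
    assert (0 < g0 t) by (apply Hp; lra).
    repeat split; now apply Rdiv_le_0_compat.
  - intros t Ht; eapply is_derive_eq; [apply is_derive_Rdiv; auto|].
    simpl; field; split; [now apply Hq|lra].
  - intros t Ht; eapply is_derive_eq; [apply is_derive_Rdiv; auto|].
    simpl; field; split; [now apply Hq|lra].
  - intros t Ht; eapply is_derive_eq; [apply is_derive_Rdiv; auto|].
    simpl; field; split; [now apply Hq|lra].
  - intros t Ht; eapply is_derive_eq; [apply is_derive_Rdiv; auto|].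
    simpl; field; split; [now apply Hq|lra].
  - intros t Ht; eapply is_derive_eq; [apply is_derive_Rdiv; auto|].
    simpl; field; split; [now apply Hq|lra].
Qed.

(** The coupling treats all reflections alike and all rotations alike, and the parameters enter only
    through the rates and [A B = u v]. Hence [u, v] and [A, B] can be exchanged independently,
    although the diagram automorphism of the root system exchanges both pairs at once. This allows
    the later reduction to [v <= u] and [B <= A]. *)
Lemma ratio_system_swap_odd k u v A B g r1 r2 r3 r4 r5 :
  ratio_system k u v A B g r1 r2 r3 r4 r5 -> ratio_system k v u A B g r2 r1 r3 r4 r5.
Proof.
  intros [pk pu pv pA pB pAB g0 gc gp gd (i1 & i2 & i3 & i4 & i5)
    c1 c2 c3 c4 c5 hp d1 d2 d3 d4 d5].
  constructor; try assumption; try tauto; try lra.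
  - intros t Ht; eapply is_derive_eq; [now apply gd|ring].
  - intros t Ht; specialize (hp t Ht); tauto.
  - intros t Ht; eapply is_derive_eq; [now apply d2|ring].
  - intros t Ht; eapply is_derive_eq; [now apply d1|ring].
  - intros t Ht; eapply is_derive_eq; [now apply d3|ring].
  - intros t Ht; eapply is_derive_eq; [now apply d4|ring].
  - intros t Ht; eapply is_derive_eq; [now apply d5|ring].
Qed.

Lemma ratio_system_swap_even k u v A B g r1 r2 r3 r4 r5 :
  ratio_system k u v A B g r1 r2 r3 r4 r5 -> ratio_system k u v B A g r1 r2 r3 r5 r4.
Proof.
  intros [pk pu pv pA pB pAB g0 gc gp gd (i1 & i2 & i3 & i4 & i5)
    c1 c2 c3 c4 c5 hp d1 d2 d3 d4 d5].
  constructor; try assumption; try tauto; try lra.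
  - intros t Ht; specialize (hp t Ht); tauto.
  - intros t Ht; eapply is_derive_eq; [now apply d1|ring].
  - intros t Ht; eapply is_derive_eq; [now apply d2|ring].
  - intros t Ht; eapply is_derive_eq; [now apply d3|ring].
Qed.

Definition c_odd (k : R) : R := k / (1 + 3 * k).
Definition C_odd (k : R) : R := 6 * k + 3.
(** This is the constant of [even_upper] for [C1 = 3 * C_odd k], the factor 3 being the number of
    reflections in the source. *)
Definition C_even (k : R) : R := 25 + 4 * k * (3 * C_odd k).
Definition c_even (k : R) : R := Rmin (1 / 2) (k * c_odd k / 2).

Lemma c_odd_pos k : 0 < k -> 0 < c_odd k.
Proof. intros; apply Rdiv_lt_0_compat; lra. Qed.

Lemma c_even_pos k : 0 < k -> 0 < c_even k.
Proof.
  intros Hk; assert (H := c_odd_pos k Hk).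
  apply Rmin_glb_lt; [lra|]. apply Rdiv_lt_0_compat; [nra|lra].
Qed.

Lemma C_even_pos k : 0 < k -> 0 < C_even k.
Proof. intros Hk; unfold C_even, C_odd; nra. Qed.

Section Ratios.

Variables (k u v A B : R) (g r1 r2 r3 r4 r5 : R -> R).
Hypothesis rs : ratio_system k u v A B g r1 r2 r3 r4 r5.

Lemma ratio_even_le_1 (t : R) : 0 < t -> r4 t <= 1 /\ r5 t <= 1.
Proof.
  intros Ht.
  pose proof rs as [pk pu pv pA pB pAB g0 gc gp gd (i1 & i2 & i3 & i4 & i5)
    c1 c2 c3 c4 c5 hp d1 d2 d3 d4 d5].
  assert (HS : forall t, 0 < t -> 0 <= r1 t + r2 t + r3 t).
  { intros s Hs; specialize (hp s Hs); lra. }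
  split.
  - apply (even_le_1 k (u + v + B) r4 (fun t => r1 t + r2 t + r3 t)); auto; lra.
  - apply (even_le_1 k (u + v + A) r5 (fun t => r1 t + r2 t + r3 t)); auto; lra.
Qed.

(** The sum [S] satisfies [S' <= (k / t) (9 - S^2)], because the rotation ratios are at most 1 and
    the damping terms are nonpositive. *)
Lemma ratio_odd_sum_le_3 (t : R) : 0 < t -> r1 t + r2 t + r3 t <= 3.
Proof.
  intros Ht.
  pose proof rs as [pk pu pv pA pB pAB g0 gc gp gd (i1 & i2 & i3 & i4 & i5)
    c1 c2 c3 c4 c5 hp d1 d2 d3 d4 d5].
  enough (0 <= 3 - (r1 t + r2 t + r3 t)) by lra.
  refine (barrier (fun t => 3 - (r1 t + r2 t + r3 t)) (fun t => 0 -
    ((- u * r1 t + k / t * (1 + r4 t + r5 t - r1 t * (r1 t + r2 t + r3 t)))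
    + (- v * r2 t + k / t * (1 + r4 t + r5 t - r2 t * (r1 t + r2 t + r3 t)))
    + (- (u + v + A + B) * r3 t + k / t * (1 + r4 t + r5 t - r3 t * (r1 t + r2 t + r3 t)))))
    t Ht _ _ _ _).
  - simpl; lra.
  - apply continuous_Rminus; [apply continuous_const|].
    now apply continuous_Rplus; [apply continuous_Rplus|].
  - intros s Hs; apply is_derive_Rminus; [apply (@is_derive_const R_AbsRing R_NormedModule)|].
    apply is_derive_Rplus; [apply is_derive_Rplus|]; auto.
  - intros s Hs Hneg. destruct (hp s Hs) as (h1 & h2 & h3 & h4 & h5).
    destruct (ratio_even_le_1 s Hs) as [h6 h7].
    assert (Hks : 0 < k / s) by now apply Rdiv_lt_0_compat.
    set (S := r1 s + r2 s + r3 s) in *.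
    assert (HS : 3 * (1 + r4 s + r5 s) - S * S <= 0) by nra.
    replace (0 - _) with (u * r1 s + v * r2 s + (u + v + A + B) * r3 s
      - k / s * (3 * (1 + r4 s + r5 s) - S * S)) by (unfold S; ring).
    assert (k / s * (3 * (1 + r4 s + r5 s) - S * S) <= 0) by nra.
    assert (0 <= u * r1 s) by nra. assert (0 <= v * r2 s) by nra.
    assert (0 <= (u + v + A + B) * r3 s) by nra. lra.
Qed.

Lemma ratio_odd_bounds (t : R) : 0 < t ->
  c_odd k / (1 + u * t) <= r1 t <= C_odd k / (1 + u * t) /\
  c_odd k / (1 + v * t) <= r2 t <= C_odd k / (1 + v * t) /\
  c_odd k / (1 + (u + v + A + B) * t) <= r3 t <= C_odd k / (1 + (u + v + A + B) * t).
Proof.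
  intros Ht.
  pose proof rs as [pk pu pv pA pB pAB g0 gc gp gd (i1 & i2 & i3 & i4 & i5)
    c1 c2 c3 c4 c5 hp d1 d2 d3 d4 d5].
  pose (P := fun t => 1 + r4 t + r5 t). pose (S := fun t => r1 t + r2 t + r3 t).
  assert (HP : forall s, 0 < s -> 1 <= P s <= 3).
  { intros s Hs; unfold P; specialize (hp s Hs); generalize (ratio_even_le_1 s Hs); lra. }
  assert (HS : forall s, 0 < s -> S s <= 3) by (intros s Hs; now apply ratio_odd_sum_le_3).
  assert (Hu1 : forall s, 0 < s -> P s <= 3 /\ 0 <= r1 s <= S s).
  { intros s Hs; specialize (HP s Hs); specialize (hp s Hs); unfold S; lra. }
  assert (Hu2 : forall s, 0 < s -> P s <= 3 /\ 0 <= r2 s <= S s).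
  { intros s Hs; specialize (HP s Hs); specialize (hp s Hs); unfold S; lra. }
  assert (Hu3 : forall s, 0 < s -> P s <= 3 /\ 0 <= r3 s <= S s).
  { intros s Hs; specialize (HP s Hs); specialize (hp s Hs); unfold S; lra. }
  assert (Hl1 : forall s, 0 < s -> 1 <= P s /\ 0 <= r1 s /\ S s <= 3).
  { intros s Hs; specialize (HP s Hs); specialize (hp s Hs); specialize (HS s Hs); lra. }
  assert (Hl2 : forall s, 0 < s -> 1 <= P s /\ 0 <= r2 s /\ S s <= 3).
  { intros s Hs; specialize (HP s Hs); specialize (hp s Hs); specialize (HS s Hs); lra. }
  assert (Hl3 : forall s, 0 < s -> 1 <= P s /\ 0 <= r3 s /\ S s <= 3).
  { intros s Hs; specialize (HP s Hs); specialize (hp s Hs); specialize (HS s Hs); lra. }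
  unfold c_odd, C_odd.
  repeat split.
  - apply (odd_lower k u r1 P S); auto; lra.
  - apply (odd_upper k u r1 P S); auto; lra.
  - apply (odd_lower k v r2 P S); auto; lra.
  - apply (odd_upper k v r2 P S); auto; lra.
  - apply (odd_lower k (u + v + A + B) r3 P S); auto; lra.
  - apply (odd_upper k (u + v + A + B) r3 P S); auto; lra.
Qed.

(** The source of both rotations is the sum of the reflection ratios. Its slowest term decays at the
    smallest rate, here [v], so the sum is of order [/ (1 + v * t)]. *)
Lemma ratio_even_bounds (t : R) : v <= u -> 0 < t ->
  c_even k / ((1 + v * t) * (1 + (u + v + B) * t)) <= r4 t
    <= C_even k / ((1 + v * t) * (1 + (u + v + B) * t)) /\
  c_even k / ((1 + v * t) * (1 + (u + v + A) * t)) <= r5 t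
    <= C_even k / ((1 + v * t) * (1 + (u + v + A) * t)).
Proof.
  intros Hvu Ht.
  pose proof rs as [pk pu pv pA pB pAB g0 gc gp gd (i1 & i2 & i3 & i4 & i5)
    c1 c2 c3 c4 c5 hp d1 d2 d3 d4 d5].
  pose (S := fun t => r1 t + r2 t + r3 t).
  assert (HC : 0 < C_odd k) by (unfold C_odd; lra).
  assert (Hc := c_odd_pos k pk). assert (Hce := c_even_pos k pk).
  assert (Hce1 : c_even k <= 1 / 2) by apply Rmin_l.
  assert (Hce2 : c_even k <= k * c_odd k / 2) by apply Rmin_r.
  assert (HSu : forall s, 0 < s -> 0 <= S s <= 3 * C_odd k / (1 + v * s)).
  { intros s Hs; destruct (ratio_odd_bounds s Hs) as ([_ h1] & [_ h2] & [_ h3]).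
    specialize (hp s Hs).
    assert (0 < v * s) by nra.
    assert (Hm : forall x, v * s <= x -> C_odd k / (1 + x) <= C_odd k / (1 + v * s)).
    { intros x Hx; apply Rmult_le_compat_l; [lra|].
      apply Rinv_le_contravar; lra. }
    assert (h1' := Hm (u * s) ltac:(nra)).
    assert (h3' := Hm ((u + v + A + B) * s) ltac:(nra)).
    unfold S; split; [lra|]. lra. }
  assert (HSl : forall s, 0 < s -> c_odd k / (1 + v * s) <= S s).
  { intros s Hs; destruct (ratio_odd_bounds s Hs) as (_ & [h2 _] & _).
    specialize (hp s Hs); unfold S; lra. }
  assert (Hu4 : forall s, 0 < s -> 0 <= r4 s /\ 0 <= S s <= 3 * C_odd k / (1 + v * s)).
  { intros s Hs; split; [apply hp|apply HSu]; auto. }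
  assert (Hu5 : forall s, 0 < s -> 0 <= r5 s /\ 0 <= S s <= 3 * C_odd k / (1 + v * s)).
  { intros s Hs; split; [apply hp|apply HSu]; auto. }
  assert (Hl4 : forall s, 0 < s -> 0 <= r4 s /\ c_odd k / (1 + v * s) <= S s).
  { intros s Hs; split; [apply hp|apply HSl]; auto. }
  assert (Hl5 : forall s, 0 < s -> 0 <= r5 s /\ c_odd k / (1 + v * s) <= S s).
  { intros s Hs; split; [apply hp|apply HSl]; auto. }
  unfold C_even.
  repeat split.
  - apply (even_lower k v (u + v + B) (c_odd k) (c_even k) r4 S); auto; lra.
  - apply (even_upper k v (u + v + B) (3 * C_odd k) r4 S); auto; lra.
  - apply (even_lower k v (u + v + A) (c_odd k) (c_even k) r5 S); auto; lra.
  - apply (even_upper k v (u + v + A) (3 * C_odd k) r5 S); auto; lra.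
Qed.

End Ratios.

(** * The size of the identity component, regime by regime *)

Lemma derive_abs_le (F F' Q Q' : R -> R) (s t : R) : s <= t ->
  (forall x, s <= x <= t -> is_derive F x (F' x)) ->
  (forall x, s <= x <= t -> is_derive Q x (Q' x)) ->
  (forall x, s <= x <= t -> Rabs (F' x) <= Q' x) ->
  Rabs (F t - F s) <= Q t - Q s.
Proof.
  intros Hst HF HQ Hb; apply Rabs_le.
  assert (H1 : Q s - F s <= Q t - F t).
  { apply (nonneg_derive_le (fun x => Q x - F x) (fun x => Q' x - F' x)); [exact Hst| |].
    - intros x Hx; apply is_derive_Rminus; auto.
    - intros x Hx; specialize (Hb x Hx); apply Rabs_le_between in Hb; lra. }
  assert (H2 : Q s + F s <= Q t + F t).
  { apply (nonneg_derive_le (fun x => Q x + F x) (fun x => Q' x + F' x)); [exact Hst| |].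
    - intros x Hx; apply is_derive_Rplus; auto.
    - intros x Hx; specialize (Hb x Hx); apply Rabs_le_between in Hb; lra. }
  lra.
Qed.

(* With [H' ~ (k/t)(sigma - n)] and [sigma' ~ (k/t)(n^2 - sigma^2)], the sum
   [H + ln (n + sigma)] has integrable derivative. *)
Lemma regime_step (k n K M kappa s t : R) (H H' sigma sigma' rho rho' : R -> R) :
  1 <= n <= 3 -> 0 <= K -> 0 <= M -> 0 < s <= t -> M * t <= 6 -> 0 <= kappa <= s ->
  (forall x, s <= x <= t -> is_derive H x (H' x)) ->
  (forall x, s <= x <= t -> is_derive sigma x (sigma' x)) ->
  (forall x, s <= x <= t -> is_derive rho x (rho' x)) ->
  (forall x, s <= x <= t -> 0 <= sigma x <= 3 /\ 0 <= rho x <= 2) ->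
  (forall x, s <= x <= t -> Rabs (H' x + k / x * (n - sigma x)) <= K * (M + kappa / x ^ 2)) ->
  (forall x, s <= x <= t -> Rabs (sigma' x - k / x * (n ^ 2 - sigma x ^ 2))
     <= K * (M + kappa / x ^ 2 + rho' x)) ->
  Rabs (H t - H s) <= 16 * K + 5.
Proof.
  intros Hn HK HM Hst HMt Hkap dH dsig drho Hb HbH Hbs.
  assert (Hln : forall x, s <= x <= t -> 0 <= ln (n + sigma x) <= 5).
  { intros x Hx; destruct (Hb x Hx) as [Hs _]; split.
    - rewrite <- ln_1; apply ln_le; lra.
    - apply Rle_trans with (n + sigma x - 1); [|lra].
      assert (Hq := exp_ineq1_le (ln (n + sigma x))).
      rewrite exp_ln in Hq by lra. lra. }
  assert (Hmain : Rabs ((H t + ln (n + sigma t)) - (H s + ln (n + sigma s)))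
    <= K * (2 * M * t - 2 * kappa / t + rho t) - K * (2 * M * s - 2 * kappa / s + rho s)).
  { apply (derive_abs_le (fun x => H x + ln (n + sigma x))
      (fun x => H' x + sigma' x / (n + sigma x))
      (fun x => K * (2 * M * x - 2 * kappa / x + rho x))
      (fun x => K * (2 * M + 2 * kappa / x ^ 2 + rho' x))); [lra| | |].
    - intros x Hx; apply is_derive_Rplus; [auto|].
      destruct (Hb x Hx) as [Hs _].
      eapply is_derive_eq.
      + apply (is_derive_comp ln (fun y => n + sigma y)).
        * apply is_derive_Reals, derivable_pt_lim_ln; lra.
        * apply is_derive_Rplus; [apply (@is_derive_const R_AbsRing R_NormedModule)|now apply dsig].
      + unfold scal, zero; simpl; unfold mult; simpl; field; lra.
    - intros x Hx.
      eapply is_derive_eq.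
      + apply is_derive_Rmult; [apply (@is_derive_const R_AbsRing R_NormedModule)|].
        apply is_derive_Rplus; [|now apply drho].
        instantiate (1 := 2 * M + 2 * kappa / x ^ 2).
        auto_derive; [lra|field; lra].
      + unfold zero; simpl; ring.
    - intros x Hx; destruct (Hb x Hx) as [Hs _].
      specialize (HbH x Hx); specialize (Hbs x Hx).
      replace (H' x + sigma' x / (n + sigma x)) with ((H' x + k / x * (n - sigma x))
        + (sigma' x - k / x * (n ^ 2 - sigma x ^ 2)) * / (n + sigma x)) by (field; lra).
      apply Rle_trans with (1 := Rabs_triang _ _).
      rewrite Rabs_mult, (Rabs_pos_eq (/ (n + sigma x)))
        by (left; apply Rinv_0_lt_compat; lra).
      assert (Hi : 0 < / (n + sigma x) <= 1).
      { split; [apply Rinv_0_lt_compat; lra|].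
        rewrite <- Rinv_1; apply Rinv_le_contravar; lra. }
      set (y := Rabs (sigma' x - k / x * (n ^ 2 - sigma x ^ 2))) in *.
      assert (0 <= y) by apply Rabs_pos.
      assert (y * / (n + sigma x) <= y) by nra.
      lra. }
  assert (l1 := Hln s ltac:(lra)). assert (l2 := Hln t ltac:(lra)).
  destruct (Hb s ltac:(lra)) as [_ b1]. destruct (Hb t ltac:(lra)) as [_ b2].
  assert (e1 : 0 <= kappa / s <= 1).
  { split; [apply Rdiv_le_0_compat; lra|]. apply Rle_div_l; lra. }
  assert (e2 : 0 <= kappa / t) by (apply Rdiv_le_0_compat; lra).
  assert (e3 : 0 <= M * s) by nra.
  (* Of the 16, the bound [M * t <= 6] accounts for 12, [kappa <= s] for 2 and [rho <= 2] for 2. The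
     summand 5 of the conclusion is the possible variation of [ln (n + sigma)], where
     [n + sigma <= 6]. *)
  assert (e4 : K * (2 * M * t - 2 * kappa / t + rho t) - K * (2 * M * s - 2 * kappa / s + rho s)
     <= K * 16).
  { rewrite <- Rmult_minus_distr_l; apply Rmult_le_compat_l; [exact HK|].
    unfold Rdiv in *; lra. }
  apply Rabs_le_between in Hmain; apply Rabs_le; lra.
Qed.

(** The logarithm of the quotient of [g] by its expected size, the product of the [(1 + u_i t)^(-k)]
    over the three reflection rates. *)
Definition log_defect (k u v A B : R) (g : R -> R) (t : R) : R :=
  ln (g t) + k * (ln (1 + u * t) + ln (1 + v * t) + ln (1 + (u + v + A + B) * t)).

Lemma hyperbola_le (C a b x : R) : 0 <= C -> 0 < b <= a -> 0 < x ->
  C / (1 + a * x) <= C * / b / x.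
Proof.
  intros HC Hab Hx.
  replace (C * / b / x) with (C * / (b * x)) by (field; lra).
  assert (0 < b * x) by nra.
  apply Rmult_le_compat_l; [exact HC|]. apply Rinv_le_contravar; nra.
Qed.

Lemma hyperbola2_le (C y a b x : R) : 0 <= C -> 0 <= y -> 0 < b <= a -> 0 < x ->
  C / ((1 + y) * (1 + a * x)) <= C * / b / x.
Proof.
  intros HC Hy Hab Hx.
  apply Rle_trans with (2 := hyperbola_le C a b x HC Hab Hx).
  assert (0 < a * x) by nra.
  apply Rmult_le_compat_l; [exact HC|]. apply Rinv_le_contravar; nra.
Qed.

Lemma one_minus_hyperbola (y : R) : 0 <= y -> 0 <= 1 - / (1 + y) <= y.
Proof.
  intros Hy.
  assert (Hz : / (1 + y) * (1 + y) = 1) by (apply Rinv_l; lra).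
  assert (0 < / (1 + y)) by (apply Rinv_0_lt_compat; lra).
  nra.
Qed.

(** The parenthesis on the right is the derivative of a rotation ratio when [q = k / t]. Solving the
    equation for [q (1 - r)] requires dividing by [S], which is harmless while some reflection ratio
    stays bounded below. The defect is thus traded for a total derivative plus a constant rate. *)
Lemma even_defect (c q r S d : R) : 0 < c -> 0 < q -> 0 <= r <= 1 -> 0 <= d -> c / 2 <= S ->
  0 <= q * (1 - r) <= 2 / c * ((- d * r + q * (S * (1 - r))) + d).
Proof.
  intros Hc Hq Hr Hd HS.
  assert (0 <= q * (1 - r)) by nra. split; [assumption|].
  replace (- d * r + q * (S * (1 - r)) + d) with (S * (q * (1 - r)) + d * (1 - r)) by ring.
  apply Rle_trans with (2 / c * (S * (q * (1 - r)))).
  - apply Rle_trans with (2 / c * (c / 2 * (q * (1 - r)))).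
    + right; field; lra.
    + apply Rmult_le_compat_l; [apply Rdiv_le_0_compat; lra|].
      apply Rmult_le_compat_r; lra.
  - apply Rmult_le_compat_l; [apply Rdiv_le_0_compat; lra|]. nra.
Qed.

(** One constant large enough for the error terms of all regimes; the term in [/ c_odd k] pays for
    [even_defect]. *)
Definition K_reg (k : R) : R := 3 + 3 * k + 12 / c_odd k + 10 * k * (C_odd k + C_even k + 1).

Section Regimes.

Variables (k u v A B : R) (g r1 r2 r3 r4 r5 : R -> R).
Hypothesis rs : ratio_system k u v A B g r1 r2 r3 r4 r5.
Hypothesis Hvu : v <= u.
Hypothesis HBA : B <= A.

Let w := u + v + A + B.
Let H := log_defect k u v A B g.
Let H' := fun t => k / t *
  (r1 t + r2 t + r3 t - / (1 + u * t) - / (1 + v * t) - / (1 + w * t)).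

Lemma is_derive_log_defect (t : R) : 0 < t -> is_derive H t (H' t).
Proof.
  intros Ht.
  pose proof rs as [pk pu pv pA pB pAB g0 gc gp gd _ _ _ _ _ _ _ _ _ _ _ _].
  assert (0 < u * t) by nra. assert (0 < v * t) by nra.
  assert (0 < w * t) by (unfold w; nra).
  unfold H, log_defect; fold w.
  eapply is_derive_eq.
  - apply is_derive_Rplus.
    + apply (is_derive_comp ln g).
      * apply is_derive_Reals, derivable_pt_lim_ln; auto.
      * now apply gd.
    + instantiate (1 := k * (u / (1 + u * t) + v / (1 + v * t) + w / (1 + w * t))).
      auto_derive; [lra|field; lra].
  - unfold H'; unfold scal; simpl; unfold mult; simpl.
    assert (g t <> 0) by (specialize (gp t Ht); lra).
    field; lra.
Qed.

Lemma K_reg_pos : 0 <= K_reg k.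
Proof.
  pose proof (rs_k _ _ _ _ _ _ _ _ _ _ _ rs) as pk.
  assert (Hc := c_odd_pos k pk). assert (HC := C_even_pos k pk).
  assert (0 < C_odd k) by (unfold C_odd; lra).
  assert (0 < 12 / c_odd k) by (apply Rdiv_lt_0_compat; lra).
  assert (0 < k * (C_odd k + C_even k + 1)) by nra.
  unfold K_reg; lra.
Qed.

(** No rate has acted yet, so [n = 3]. Since [3 (1 + r4 + r5) = 9 - 3 (1 - r4) - 3 (1 - r5)], the
    defects of both rotations go into [rho = r4 + r5], and the remaining errors are of the order of
    the largest rate [w]. *)
Lemma regime_low (s t : R) : 0 < s <= t -> w * t <= 1 ->
  Rabs (H t - H s) <= 16 * K_reg k + 5.
Proof.
  intros Hst Hwt.
  pose proof rs as [pk pu pv pA pB pAB g0 gc gp gd _ _ _ _ _ _ hp d1 d2 d3 d4 d5].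
  assert (Hc := c_odd_pos k pk). assert (HCe := C_even_pos k pk).
  assert (HC : 0 < C_odd k) by (unfold C_odd; lra).
  assert (Hc12 : 0 < 12 / c_odd k) by (apply Rdiv_lt_0_compat; lra).
  assert (HkC : 0 < k * (C_odd k + C_even k + 1)) by nra.
  assert (Hw : 0 < w) by (unfold w; lra).
  apply (regime_step k 3 (K_reg k) (3 * w) 0 s t H H'
    (fun x => r1 x + r2 x + r3 x)
    (fun x => (- u * r1 x + k / x * (1 + r4 x + r5 x - r1 x * (r1 x + r2 x + r3 x)))
    + (- v * r2 x + k / x * (1 + r4 x + r5 x - r2 x * (r1 x + r2 x + r3 x)))
    + (- (u + v + A + B) * r3 x + k / x * (1 + r4 x + r5 x - r3 x * (r1 x + r2 x + r3 x))))
    (fun x => r4 x + r5 x)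
    (fun x => (- (u + v + B) * r4 x + k / x * ((r1 x + r2 x + r3 x) * (1 - r4 x)))
    + (- (u + v + A) * r5 x + k / x * ((r1 x + r2 x + r3 x) * (1 - r5 x)))));
    try lra.
  - apply K_reg_pos.
  - intros x Hx; apply is_derive_log_defect; lra.
  - intros x Hx; apply is_derive_Rplus; [apply is_derive_Rplus|]; [apply d1|apply d2|apply d3]; lra.
  - intros x Hx; apply is_derive_Rplus; [apply d4|apply d5]; lra.
  - intros x Hx; assert (Hx0 : 0 < x) by lra.
    generalize (hp x Hx0) (ratio_even_le_1 _ _ _ _ _ _ _ _ _ _ _ rs x Hx0)
      (ratio_odd_sum_le_3 _ _ _ _ _ _ _ _ _ _ _ rs x Hx0). lra.
  - intros x Hx; assert (Hx0 : 0 < x) by lra.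
    assert (0 < u * x) by nra. assert (0 < v * x) by nra. assert (0 < w * x) by nra.
    assert (o1 := one_minus_hyperbola (u * x) ltac:(lra)).
    assert (o2 := one_minus_hyperbola (v * x) ltac:(lra)).
    assert (o3 := one_minus_hyperbola (w * x) ltac:(lra)).
    unfold H'.
    replace (k / x * _ + k / x * _) with
      (k / x * ((1 - / (1 + u * x)) + (1 - / (1 + v * x)) + (1 - / (1 + w * x)))) by ring.
    assert (Hq : 0 < k / x) by now apply Rdiv_lt_0_compat.
    rewrite Rabs_pos_eq by (apply Rmult_le_pos; lra).
    apply Rle_trans with (k / x * (3 * w * x)).
    + apply Rmult_le_compat_l; [lra|].
      assert (u * x <= w * x) by (unfold w; nra). assert (v * x <= w * x) by (unfold w; nra). lra.
    + replace (k / x * (3 * w * x)) with (3 * k * w) by (field; lra).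
      replace (K_reg k * (3 * w + 0 / x ^ 2)) with (K_reg k * (3 * w)) by (field; lra).
      assert (3 * k * w <= K_reg k * w) by (apply Rmult_le_compat_r; unfold K_reg; lra).
      assert (0 <= K_reg k * w) by (apply Rmult_le_pos; [apply K_reg_pos|lra]). lra.
  - intros x Hx; assert (Hx0 : 0 < x) by lra.
    assert (Hq : 0 < k / x) by now apply Rdiv_lt_0_compat.
    destruct (hp x Hx0) as (h1 & h2 & h3 & h4 & h5).
    destruct (ratio_even_le_1 _ _ _ _ _ _ _ _ _ _ _ rs x Hx0) as [h6 h7].
    assert (hS := ratio_odd_sum_le_3 _ _ _ _ _ _ _ _ _ _ _ rs x Hx0).
    destruct (ratio_odd_bounds _ _ _ _ _ _ _ _ _ _ _ rs x Hx0) as (_ & _ & [h8 _]).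
    fold w in h8 |- *.
    assert (hc : c_odd k / 2 <= c_odd k / (1 + w * x)).
    { apply Rmult_le_compat_l; [lra|]. apply Rinv_le_contravar; nra. }
    set (S := r1 x + r2 x + r3 x) in *.
    assert (hcS : c_odd k / 2 <= S) by (unfold S; lra).
    assert (e4 := even_defect (c_odd k) (k / x) (r4 x) S (u + v + B)
      ltac:(lra) ltac:(lra) ltac:(lra) ltac:(lra) hcS).
    assert (e5 := even_defect (c_odd k) (k / x) (r5 x) S (u + v + A)
      ltac:(lra) ltac:(lra) ltac:(lra) ltac:(lra) hcS).
    set (p4 := - (u + v + B) * r4 x + k / x * (S * (1 - r4 x))) in *.
    set (p5 := - (u + v + A) * r5 x + k / x * (S * (1 - r5 x))) in *.
    assert (f4 : 0 <= p4 + (u + v + B)).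
    { apply Rmult_le_reg_l with (2 / c_odd k); [apply Rdiv_lt_0_compat; lra|lra]. }
    assert (f5 : 0 <= p5 + (u + v + A)).
    { apply Rmult_le_reg_l with (2 / c_odd k); [apply Rdiv_lt_0_compat; lra|lra]. }
    set (D := u * r1 x + v * r2 x + w * r3 x).
    assert (HD : 0 <= D <= 3 * w).
    { unfold D; assert (u <= w) by (unfold w; lra). assert (v <= w) by (unfold w; lra).
      assert (u * r1 x <= w * r1 x) by nra. assert (v * r2 x <= w * r2 x) by nra.
      assert (0 <= u * r1 x) by nra. assert (0 <= v * r2 x) by nra.
      assert (0 <= w * r3 x) by nra. assert (w * S <= w * 3) by nra.
      unfold S in *; lra. }
    replace (_ - _) with (- D - 3 * (k / x * (1 - r4 x)) - 3 * (k / x * (1 - r5 x)))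
      by (unfold D, S; ring).
    replace (K_reg k * (3 * w + 0 / x ^ 2 + (p4 + p5))) with
      (K_reg k * (p4 + p5 + 2 * w) + K_reg k * w) by (field; lra).
    assert (k1 : 3 * w <= K_reg k * w) by (apply Rmult_le_compat_r; unfold K_reg; lra).
    assert (k2 : 6 / c_odd k * (p4 + p5 + 2 * w) <= K_reg k * (p4 + p5 + 2 * w)).
    { apply Rmult_le_compat_r; [unfold w in *; lra|].
      unfold K_reg. replace (12 / c_odd k) with (2 * (6 / c_odd k)) in * by (field; lra). lra. }
    assert (k3 : 2 / c_odd k * (p4 + (u + v + B)) + 2 / c_odd k * (p5 + (u + v + A))
      <= 2 / c_odd k * (p4 + p5 + 2 * w)).
    { rewrite <- Rmult_plus_distr_l; apply Rmult_le_compat_l;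
        [apply Rdiv_le_0_compat; lra|unfold w; lra]. }
    replace (6 / c_odd k * (p4 + p5 + 2 * w)) with (3 * (2 / c_odd k * (p4 + p5 + 2 * w)))
      in k2 by (field; lra).
    apply Rabs_le; lra.
Qed.

(** Here [n = 2] with [sigma = r1 + r2]. The ratios [r3] and [r5] have decayed like [/ (w * x)],
    while [r4] survives and plays the role of [rho], so that [2 (1 + r4 + r5)] is 4 up to controlled
    errors. *)
Lemma regime_middle (s t : R) : 0 < s <= t -> 1 <= w * s -> u * t <= 1 ->
  Rabs (H t - H s) <= 16 * K_reg k + 5.
Proof.
  intros Hst Hws Hut.
  pose proof rs as [pk pu pv pA pB pAB g0 gc gp gd _ _ _ _ _ _ hp d1 d2 d3 d4 d5].
  assert (Hc := c_odd_pos k pk). assert (HCe := C_even_pos k pk).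
  assert (HC : 0 < C_odd k) by (unfold C_odd; lra).
  assert (Hc12 : 0 < 12 / c_odd k) by (apply Rdiv_lt_0_compat; lra).
  assert (HkC : 0 < k * C_odd k) by nra. assert (HkCe : 0 < k * C_even k) by nra.
  assert (Hw : 0 < w) by (unfold w; lra).
  (* From [B <= A] and [v <= u] one gets [B^2 <= A B = u v <= u^2]. This keeps the rate [d] of [r4]
     below [3 u], hence [d * t <= 3] on the whole range. *)
  assert (HBu : B <= u).
  { destruct (Rle_lt_dec B u); [assumption|exfalso].
    assert (u * v < A * B); [|lra].
    apply Rle_lt_trans with (u * u); [nra|]. nra. }
  set (d := u + v + B) in *.
  assert (Hdt : d * t <= 3) by (unfold d; nra).
  assert (Hd : 0 < d) by (unfold d; lra).
  assert (Hkap : 0 < / w <= s).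
  { split; [now apply Rinv_0_lt_compat|].
    apply Rmult_le_reg_l with w; [exact Hw|]. rewrite Rinv_r; lra. }
  apply (regime_step k 2 (K_reg k) (2 * d) (/ w) s t H H'
    (fun x => r1 x + r2 x)
    (fun x => (- u * r1 x + k / x * (1 + r4 x + r5 x - r1 x * (r1 x + r2 x + r3 x)))
    + (- v * r2 x + k / x * (1 + r4 x + r5 x - r2 x * (r1 x + r2 x + r3 x))))
    r4
    (fun x => - d * r4 x + k / x * ((r1 x + r2 x + r3 x) * (1 - r4 x))));
    try lra.
  - apply K_reg_pos.
  - intros x Hx; apply is_derive_log_defect; lra.
  - intros x Hx; apply is_derive_Rplus; [apply d1|apply d2]; lra.
  - intros x Hx; apply d4; lra.
  - intros x Hx; assert (Hx0 : 0 < x) by lra.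
    generalize (hp x Hx0) (ratio_even_le_1 _ _ _ _ _ _ _ _ _ _ _ rs x Hx0)
      (ratio_odd_sum_le_3 _ _ _ _ _ _ _ _ _ _ _ rs x Hx0). lra.
  - intros x Hx; assert (Hx0 : 0 < x) by lra.
    assert (0 < u * x) by nra. assert (0 < v * x) by nra. assert (0 < w * x) by nra.
    assert (o1 := one_minus_hyperbola (u * x) ltac:(lra)).
    assert (o2 := one_minus_hyperbola (v * x) ltac:(lra)).
    assert (Hq : 0 < k / x) by now apply Rdiv_lt_0_compat.
    destruct (hp x Hx0) as (h1 & h2 & h3 & h4 & h5).
    destruct (ratio_odd_bounds _ _ _ _ _ _ _ _ _ _ _ rs x Hx0) as (_ & _ & [_ h8]).
    fold w in h8.
    assert (o3 := hyperbola_le (C_odd k) w w x ltac:(lra) ltac:(lra) Hx0).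
    assert (o4 := hyperbola_le 1 w w x ltac:(lra) ltac:(lra) Hx0).
    assert (o5 : 0 < / (1 + w * x)) by (apply Rinv_0_lt_compat; lra).
    set (Z := / w / x) in *.
    assert (HZ : 0 < Z) by (apply Rdiv_lt_0_compat; lra).
    replace (1 * / w / x) with Z in o4 by (unfold Z; field; lra).
    replace (C_odd k * / w / x) with (C_odd k * Z) in o3 by (unfold Z; field; lra).
    replace (/ w / x ^ 2) with (/ x * Z) by (unfold Z; field; lra).
    unfold H'.
    replace (k / x * _ + k / x * _) with
      (k / x * ((1 - / (1 + u * x)) + (1 - / (1 + v * x)) + (r3 x - / (1 + w * x)))) by ring.
    rewrite Rabs_mult, (Rabs_pos_eq (k / x)) by lra.
    apply Rle_trans with (k / x * (2 * d * x + (C_odd k + 1) * Z)).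
    + apply Rmult_le_compat_l; [lra|].
      assert (u * x + v * x <= d * x) by (unfold d; nra). assert (0 < d * x) by nra.
      assert (0 < C_odd k * Z) by nra.
      unfold Rdiv in o4; rewrite Rmult_1_l in o4.
      apply Rabs_le; lra.
    + replace (k / x * (2 * d * x + (C_odd k + 1) * Z)) with
        (k * (2 * d) + k * (C_odd k + 1) * (/ x * Z)) by (field; lra).
      assert (0 < / x * Z) by (apply Rmult_lt_0_compat; [now apply Rinv_0_lt_compat|lra]).
      rewrite (Rmult_plus_distr_l (K_reg k)).
      apply Rplus_le_compat; apply Rmult_le_compat_r; try lra; unfold K_reg; lra.
  - intros x Hx; assert (Hx0 : 0 < x) by lra.
    assert (Hq : 0 < k / x) by now apply Rdiv_lt_0_compat.
    destruct (hp x Hx0) as (h1 & h2 & h3 & h4 & h5).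
    destruct (ratio_even_le_1 _ _ _ _ _ _ _ _ _ _ _ rs x Hx0) as [h6 h7].
    assert (hS := ratio_odd_sum_le_3 _ _ _ _ _ _ _ _ _ _ _ rs x Hx0).
    destruct (ratio_odd_bounds _ _ _ _ _ _ _ _ _ _ _ rs x Hx0) as ([h8 _] & _ & [_ h9]).
    destruct (ratio_even_bounds _ _ _ _ _ _ _ _ _ _ _ rs x Hvu Hx0) as (_ & [_ h10]).
    fold w in h9.
    assert (o3 := hyperbola_le (C_odd k) w w x ltac:(lra) ltac:(lra) Hx0).
    assert (o5 := hyperbola2_le (C_even k) (v * x) (u + v + A) (w / 2) x
      ltac:(lra) ltac:(nra) ltac:(unfold w; lra) Hx0).
    set (Z := / w / x) in *.
    assert (HZ : 0 < Z) by (apply Rdiv_lt_0_compat; lra).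
    replace (C_even k * / (w / 2) / x) with (2 * C_even k * Z) in o5 by (unfold Z; field; lra).
    replace (C_odd k * / w / x) with (C_odd k * Z) in o3 by (unfold Z; field; lra).
    replace (/ w / x ^ 2) with (/ x * Z) by (unfold Z; field; lra).
    assert (HZx : 0 < / x * Z) by (apply Rmult_lt_0_compat; [now apply Rinv_0_lt_compat|lra]).
    assert (hc : c_odd k / 2 <= c_odd k / (1 + u * x)).
    { apply Rmult_le_compat_l; [lra|]. apply Rinv_le_contravar; nra. }
    assert (hcS : c_odd k / 2 <= r1 x + r2 x + r3 x) by lra.
    assert (e4 := even_defect (c_odd k) (k / x) (r4 x) (r1 x + r2 x + r3 x) d
      ltac:(lra) ltac:(lra) ltac:(lra) ltac:(lra) hcS).
    set (p4 := - d * r4 x + k / x * ((r1 x + r2 x + r3 x) * (1 - r4 x))) in *.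
    assert (f4 : 0 <= p4 + d).
    { apply Rmult_le_reg_l with (2 / c_odd k); [apply Rdiv_lt_0_compat; lra|lra]. }
    set (D := u * r1 x + v * r2 x).
    assert (HD : 0 <= D <= 3 * d).
    { unfold D; assert (u <= d) by (unfold d; lra). assert (v <= d) by (unfold d; lra).
      assert (u * r1 x <= d * r1 x) by nra. assert (v * r2 x <= d * r2 x) by nra.
      assert (0 <= u * r1 x) by nra. assert (0 <= v * r2 x) by nra.
      assert (d * (r1 x + r2 x) <= d * 3) by (apply Rmult_le_compat_l; lra).
      lra. }
    replace (_ - _) with (- D + 2 * (k / x * r5 x) - 2 * (k / x * (1 - r4 x))
      - k / x * ((r1 x + r2 x) * r3 x)) by (unfold D; ring).
    assert (b5 : 0 <= k / x * r5 x <= 2 * k * C_even k * (/ x * Z)).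
    { split; [apply Rmult_le_pos; lra|].
      replace (2 * k * C_even k * (/ x * Z)) with (k / x * (2 * C_even k * Z)) by (field; lra).
      apply Rmult_le_compat_l; lra. }
    assert (b3 : 0 <= k / x * ((r1 x + r2 x) * r3 x) <= 3 * k * C_odd k * (/ x * Z)).
    { split; [apply Rmult_le_pos; [lra|]; apply Rmult_le_pos; lra|].
      replace (3 * k * C_odd k * (/ x * Z)) with (k / x * (3 * (C_odd k * Z))) by (field; lra).
      apply Rmult_le_compat_l; [lra|]. apply Rmult_le_compat; lra. }
    replace (K_reg k * (2 * d + / x * Z + p4)) with
      (K_reg k * (p4 + d) + K_reg k * d + K_reg k * (/ x * Z)) by ring.
    assert (k1 : 3 * d <= K_reg k * d) by (apply Rmult_le_compat_r; unfold K_reg; lra).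
    assert (k2 : 4 / c_odd k * (p4 + d) <= K_reg k * (p4 + d)).
    { apply Rmult_le_compat_r; [lra|].
      unfold K_reg. replace (12 / c_odd k) with (3 * (4 / c_odd k)) in * by (field; lra). lra. }
    replace (4 / c_odd k * (p4 + d)) with (2 * (2 / c_odd k * (p4 + d)))
      in k2 by (field; lra).
    assert (k3 : 10 * k * (C_odd k + C_even k) * (/ x * Z) <= K_reg k * (/ x * Z)).
    { apply Rmult_le_compat_r; [lra|]. unfold K_reg; lra. }
    assert (0 < k * C_even k * (/ x * Z)) by (apply Rmult_lt_0_compat; lra).
    assert (0 < k * C_odd k * (/ x * Z)) by (apply Rmult_lt_0_compat; lra).
    apply Rabs_le; lra.
Qed.

(** Only [r2] survives, so [n = 1]: all other rates are at least [u], and the corresponding ratios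
    are of order at most [/ (u * x)]. No rotation needs a correction [rho]. *)
Lemma regime_high (s t : R) : 0 < s <= t -> 1 <= u * s -> v * t <= 1 ->
  Rabs (H t - H s) <= 16 * K_reg k + 5.
Proof.
  intros Hst Hus Hvt.
  pose proof rs as [pk pu pv pA pB pAB g0 gc gp gd _ _ _ _ _ _ hp d1 d2 d3 d4 d5].
  assert (Hc := c_odd_pos k pk). assert (HCe := C_even_pos k pk).
  assert (HC : 0 < C_odd k) by (unfold C_odd; lra).
  assert (Hc12 : 0 < 12 / c_odd k) by (apply Rdiv_lt_0_compat; lra).
  assert (HkC : 0 < k * C_odd k) by nra. assert (HkCe : 0 < k * C_even k) by nra.
  assert (Hkap : 0 < / u <= s).
  { split; [now apply Rinv_0_lt_compat|].
    apply Rmult_le_reg_l with u; [exact pu|]. rewrite Rinv_r; lra. }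
  apply (regime_step k 1 (K_reg k) v (/ u) s t H H' r2
    (fun x => - v * r2 x + k / x * (1 + r4 x + r5 x - r2 x * (r1 x + r2 x + r3 x)))
    (fun _ => 0) (fun _ => 0));
    try lra.
  - apply K_reg_pos.
  - intros x Hx; apply is_derive_log_defect; lra.
  - intros x Hx; apply d2; lra.
  - intros x Hx; apply (@is_derive_const R_AbsRing R_NormedModule).
  - intros x Hx; assert (Hx0 : 0 < x) by lra.
    generalize (hp x Hx0) (ratio_odd_sum_le_3 _ _ _ _ _ _ _ _ _ _ _ rs x Hx0). lra.
  - intros x Hx; assert (Hx0 : 0 < x) by lra.
    assert (0 < u * x) by nra. assert (0 < v * x) by nra. assert (0 < w * x) by (unfold w; nra).
    assert (o1 := one_minus_hyperbola (v * x) ltac:(lra)).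
    assert (Hq : 0 < k / x) by now apply Rdiv_lt_0_compat.
    destruct (hp x Hx0) as (h1 & h2 & h3 & h4 & h5).
    destruct (ratio_odd_bounds _ _ _ _ _ _ _ _ _ _ _ rs x Hx0) as ([_ h7] & _ & [_ h8]).
    fold w in h8.
    assert (o2 := hyperbola_le (C_odd k) u u x ltac:(lra) ltac:(lra) Hx0).
    assert (o3 := hyperbola_le (C_odd k) w u x ltac:(lra) ltac:(unfold w; lra) Hx0).
    assert (o4 := hyperbola_le 1 u u x ltac:(lra) ltac:(lra) Hx0).
    assert (o5 := hyperbola_le 1 w u x ltac:(lra) ltac:(unfold w; lra) Hx0).
    assert (o6 : 0 < / (1 + w * x)) by (apply Rinv_0_lt_compat; lra).
    assert (o7 : 0 < / (1 + u * x)) by (apply Rinv_0_lt_compat; lra).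
    set (Z := / u / x) in *.
    assert (HZ : 0 < Z) by (apply Rdiv_lt_0_compat; lra).
    replace (1 * / u / x) with Z in o4, o5 by (unfold Z; field; lra).
    replace (C_odd k * / u / x) with (C_odd k * Z) in o2, o3 by (unfold Z; field; lra).
    replace (/ u / x ^ 2) with (/ x * Z) by (unfold Z; field; lra).
    unfold H'.
    replace (k / x * _ + k / x * _) with
      (k / x * ((1 - / (1 + v * x)) + (r1 x - / (1 + u * x)) + (r3 x - / (1 + w * x)))) by ring.
    rewrite Rabs_mult, (Rabs_pos_eq (k / x)) by lra.
    apply Rle_trans with (k / x * (v * x + 2 * (C_odd k + 1) * Z)).
    + apply Rmult_le_compat_l; [lra|].
      assert (0 < C_odd k * Z) by nra.
      unfold Rdiv in o4, o5; rewrite Rmult_1_l in o4, o5.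
      apply Rabs_le; lra.
    + replace (k / x * (v * x + 2 * (C_odd k + 1) * Z)) with
        (k * v + 2 * k * (C_odd k + 1) * (/ x * Z)) by (field; lra).
      assert (0 < / x * Z) by (apply Rmult_lt_0_compat; [now apply Rinv_0_lt_compat|lra]).
      rewrite (Rmult_plus_distr_l (K_reg k)).
      apply Rplus_le_compat; apply Rmult_le_compat_r; try lra; unfold K_reg; lra.
  - intros x Hx; assert (Hx0 : 0 < x) by lra.
    assert (Hq : 0 < k / x) by now apply Rdiv_lt_0_compat.
    destruct (hp x Hx0) as (h1 & h2 & h3 & h4 & h5).
    assert (hS := ratio_odd_sum_le_3 _ _ _ _ _ _ _ _ _ _ _ rs x Hx0).
    destruct (ratio_odd_bounds _ _ _ _ _ _ _ _ _ _ _ rs x Hx0) as ([_ h8] & _ & [_ h9]).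
    destruct (ratio_even_bounds _ _ _ _ _ _ _ _ _ _ _ rs x Hvu Hx0) as ([_ h10] & [_ h11]).
    fold w in h9.
    assert (o2 := hyperbola_le (C_odd k) u u x ltac:(lra) ltac:(lra) Hx0).
    assert (o3 := hyperbola_le (C_odd k) w u x ltac:(lra) ltac:(unfold w; lra) Hx0).
    assert (o4 := hyperbola2_le (C_even k) (v * x) (u + v + B) u x
      ltac:(lra) ltac:(nra) ltac:(lra) Hx0).
    assert (o5 := hyperbola2_le (C_even k) (v * x) (u + v + A) u x
      ltac:(lra) ltac:(nra) ltac:(lra) Hx0).
    set (Z := / u / x) in *.
    assert (HZ : 0 < Z) by (apply Rdiv_lt_0_compat; lra).
    replace (C_even k * / u / x) with (C_even k * Z) in o4, o5 by (unfold Z; field; lra).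
    replace (C_odd k * / u / x) with (C_odd k * Z) in o2, o3 by (unfold Z; field; lra).
    replace (/ u / x ^ 2) with (/ x * Z) by (unfold Z; field; lra).
    assert (HZx : 0 < / x * Z) by (apply Rmult_lt_0_compat; [now apply Rinv_0_lt_compat|lra]).
    replace (_ - _) with (- (v * r2 x) + k / x * (r4 x + r5 x)
      - k / x * (r2 x * (r1 x + r3 x))) by ring.
    assert (HD : 0 <= v * r2 x <= 3 * v).
    { split; [nra|]. rewrite (Rmult_comm 3); apply Rmult_le_compat_l; lra. }
    assert (b5 : 0 <= k / x * (r4 x + r5 x) <= 2 * k * C_even k * (/ x * Z)).
    { split; [apply Rmult_le_pos; lra|].
      replace (2 * k * C_even k * (/ x * Z)) with (k / x * (2 * (C_even k * Z))) by (field; lra).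
      apply Rmult_le_compat_l; lra. }
    assert (b3 : 0 <= k / x * (r2 x * (r1 x + r3 x)) <= 6 * k * C_odd k * (/ x * Z)).
    { split; [apply Rmult_le_pos; [lra|]; apply Rmult_le_pos; lra|].
      replace (6 * k * C_odd k * (/ x * Z)) with (k / x * (3 * (2 * (C_odd k * Z)))) by (field; lra).
      apply Rmult_le_compat_l; [lra|]. apply Rmult_le_compat; lra. }
    replace (K_reg k * (v + / x * Z + 0)) with (K_reg k * v + K_reg k * (/ x * Z)) by ring.
    assert (k1 : 3 * v <= K_reg k * v) by (apply Rmult_le_compat_r; unfold K_reg; lra).
    assert (k3 : 10 * k * (C_odd k + C_even k) * (/ x * Z) <= K_reg k * (/ x * Z)).
    { apply Rmult_le_compat_r; [lra|]. unfold K_reg; lra. }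
    assert (0 < k * C_even k * (/ x * Z)) by (apply Rmult_lt_0_compat; lra).
    assert (0 < k * C_odd k * (/ x * Z)) by (apply Rmult_lt_0_compat; lra).
    apply Rabs_le; lra.
Qed.

(** Past [/ v] every term of [S] and of the comparison sum is [O(/ (v * x))], so [H'] is bounded by
    a multiple of [/ (v * x ^ 2)] and no cancellation is required. *)
Lemma regime_tail (s t : R) : 0 < s <= t -> 1 <= v * s ->
  Rabs (H t - H s) <= K_reg k.
Proof.
  intros Hst Hvs.
  pose proof rs as [pk pu pv pA pB pAB g0 gc gp gd _ _ _ _ _ _ hp d1 d2 d3 d4 d5].
  assert (Hc := c_odd_pos k pk). assert (HCe := C_even_pos k pk).
  assert (HC : 0 < C_odd k) by (unfold C_odd; lra).
  assert (Hc12 : 0 < 12 / c_odd k) by (apply Rdiv_lt_0_compat; lra).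
  assert (HkC : 0 < k * C_odd k) by nra. assert (HkCe : 0 < k * C_even k) by nra.
  set (K := 3 * k * (C_odd k + 1)).
  assert (HK : 0 < K <= K_reg k) by (unfold K, K_reg; lra).
  apply Rle_trans with (- K * / v / t - - K * / v / s).
  - apply (derive_abs_le H H' (fun x => - K * / v / x) (fun x => K * / v / x ^ 2)); [lra| | |].
    + intros x Hx; apply is_derive_log_defect; lra.
    + intros x Hx; auto_derive; [lra|field; lra].
    + intros x Hx; assert (Hx0 : 0 < x) by lra.
      assert (0 < u * x) by nra. assert (0 < v * x) by nra. assert (0 < w * x) by (unfold w; nra).
      assert (Hq : 0 < k / x) by now apply Rdiv_lt_0_compat.
      destruct (hp x Hx0) as (h1 & h2 & h3 & h4 & h5).
      destruct (ratio_odd_bounds _ _ _ _ _ _ _ _ _ _ _ rs x Hx0) as ([_ h7] & [_ h8] & [_ h9]).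
      fold w in h9.
      assert (o1 := hyperbola_le (C_odd k) u v x ltac:(lra) ltac:(lra) Hx0).
      assert (o2 := hyperbola_le (C_odd k) v v x ltac:(lra) ltac:(lra) Hx0).
      assert (o3 := hyperbola_le (C_odd k) w v x ltac:(lra) ltac:(unfold w; lra) Hx0).
      assert (o4 := hyperbola_le 1 u v x ltac:(lra) ltac:(lra) Hx0).
      assert (o5 := hyperbola_le 1 v v x ltac:(lra) ltac:(lra) Hx0).
      assert (o6 := hyperbola_le 1 w v x ltac:(lra) ltac:(unfold w; lra) Hx0).
      assert (o7 : 0 < / (1 + w * x)) by (apply Rinv_0_lt_compat; lra).
      assert (o8 : 0 < / (1 + u * x)) by (apply Rinv_0_lt_compat; lra).
      assert (o9 : 0 < / (1 + v * x)) by (apply Rinv_0_lt_compat; lra).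
      set (Z := / v / x) in *.
      assert (HZ : 0 < Z) by (apply Rdiv_lt_0_compat; [now apply Rinv_0_lt_compat|lra]).
      replace (1 * / v / x) with Z in o4, o5, o6 by (unfold Z; field; lra).
      replace (C_odd k * / v / x) with (C_odd k * Z) in o1, o2, o3 by (unfold Z; field; lra).
      replace (K * / v / x ^ 2) with (k / x * (3 * (C_odd k + 1) * Z))
        by (unfold Z, K; field; lra).
      unfold H'; rewrite Rabs_mult, (Rabs_pos_eq (k / x)) by lra.
      apply Rmult_le_compat_l; [lra|].
      assert (0 < C_odd k * Z) by nra.
      unfold Rdiv in o4, o5, o6; rewrite Rmult_1_l in o4, o5, o6.
      apply Rabs_le; lra.
  - assert (e1 : 0 < / v / t).
    { apply Rdiv_lt_0_compat; [now apply Rinv_0_lt_compat|lra]. }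
    assert (e2 : / v / s <= 1).
    { apply Rle_div_l; [lra|]. rewrite Rmult_1_l.
      apply Rmult_le_reg_l with v; [exact pv|]. rewrite Rinv_r; lra. }
    replace (- K * / v / t - - K * / v / s) with (K * (/ v / s) - K * (/ v / t))
      by (field; lra).
    assert (0 < K * (/ v / t)) by (apply Rmult_lt_0_compat; lra).
    assert (K * (/ v / s) <= K * 1) by (apply Rmult_le_compat_l; lra). lra.
Qed.

(** The regimes need a positive starting time because the equation is singular at 0; the value
    [H 0 = 0] is therefore used through continuity. *)
Lemma log_defect_small : exists s0, 0 < s0 /\ forall s, 0 < s < s0 -> Rabs (H s) <= 1.
Proof.
  pose proof rs as [pk pu pv pA pB pAB g0 gc gp gd _ _ _ _ _ _ _ _ _ _ _ _].
  assert (Hcont : continuous H 0).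
  { unfold H, log_defect; fold w. apply continuous_Rplus.
    - apply (continuous_comp g ln); [exact gc|].
      apply (is_derive_continuous _ _ (/ g 0)).
      apply is_derive_Reals, derivable_pt_lim_ln; lra.
    - apply (@ex_derive_continuous R_AbsRing R_NormedModule).
      auto_derive; lra. }
  assert (H0 : H 0 = 0).
  { unfold H, log_defect; rewrite !Rmult_0_r, Rplus_0_r, g0, ln_1; ring. }
  destruct (continuous_lt_locally H 0 1 Hcont) as [e1 [He1 Hs1]]; [lra|].
  destruct (continuous_gt_locally H 0 (-1) Hcont) as [e2 [He2 Hs2]]; [lra|].
  exists (Rmin e1 e2); split; [now apply Rmin_glb_lt|].
  intros s Hs; assert (Hl := Rmin_l e1 e2); assert (Hr := Rmin_r e1 e2).
  assert (H s < 1) by (apply Hs1; apply Rabs_def1; lra).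
  assert (-1 < H s) by (apply Hs2; apply Rabs_def1; lra).
  apply Rabs_le; lra.
Qed.

(** The regimes are chained at [/ w <= / u <= / v]. The constants add up as [49 = 3 * 16 + 1] (the
    tail giving the 1) and [16 = 3 * 5 + 1] (the start giving the 1). *)
Lemma log_defect_bounded_ordered (t : R) : 0 < t -> Rabs (H t) <= 49 * K_reg k + 16.
Proof.
  intros Ht.
  pose proof rs as [pk pu pv pA pB pAB g0 gc gp gd _ _ _ _ _ _ _ _ _ _ _ _].
  assert (HK := K_reg_pos).
  assert (Hw : 0 < w) by (unfold w; lra).
  assert (Hi : forall a, 0 < a -> 0 < / a /\ a * / a = 1).
  { intros a Ha; split; [now apply Rinv_0_lt_compat|apply Rinv_r; lra]. }
  destruct (Hi u pu) as [iu iu1]. destruct (Hi v pv) as [iv iv1]. destruct (Hi w Hw) as [iw iw1].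
  assert (Hwu : / w <= / u) by (apply Rinv_le_contravar; unfold w; lra).
  assert (Huv : / u <= / v) by (apply Rinv_le_contravar; lra).
  assert (B0 : forall x, 0 < x <= / w -> Rabs (H x) <= 16 * K_reg k + 6).
  { intros x Hx; destruct log_defect_small as [s0 [Hs0 Hs]].
    pose (s := Rmin x (s0 / 2)).
    assert (Hsx : 0 < s <= x /\ s < s0).
    { unfold s; generalize (Rmin_l x (s0 / 2)) (Rmin_r x (s0 / 2)).
      assert (0 < Rmin x (s0 / 2)) by (apply Rmin_glb_lt; lra). lra. }
    assert (b1 := Hs s ltac:(lra)).
    assert (b2 := regime_low s x ltac:(lra) ltac:(nra)).
    apply Rabs_le_between in b1, b2; apply Rabs_le; lra. }
  assert (B1 : forall x, 0 < x <= / u -> Rabs (H x) <= 32 * K_reg k + 11).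
  { intros x Hx; destruct (Rle_lt_dec x (/ w)) as [Hxw|Hxw].
    - assert (b := B0 x ltac:(lra)); lra.
    - assert (b1 := B0 (/ w) ltac:(lra)).
      assert (b2 := regime_middle (/ w) x ltac:(lra) ltac:(lra) ltac:(nra)).
      apply Rabs_le_between in b1, b2; apply Rabs_le; lra. }
  assert (B2 : forall x, 0 < x <= / v -> Rabs (H x) <= 48 * K_reg k + 16).
  { intros x Hx; destruct (Rle_lt_dec x (/ u)) as [Hxw|Hxw].
    - assert (b := B1 x ltac:(lra)); lra.
    - assert (b1 := B1 (/ u) ltac:(lra)).
      assert (b2 := regime_high (/ u) x ltac:(lra) ltac:(lra) ltac:(nra)).
      apply Rabs_le_between in b1, b2; apply Rabs_le; lra. }
  destruct (Rle_lt_dec t (/ v)) as [Htv|Htv].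
  - assert (b := B2 t ltac:(lra)); lra.
  - assert (b1 := B2 (/ v) ltac:(lra)).
    assert (b2 := regime_tail (/ v) t ltac:(lra) ltac:(lra)).
    apply Rabs_le_between in b1, b2; apply Rabs_le; lra.
Qed.

End Regimes.

Lemma log_defect_bounded k u v A B g r1 r2 r3 r4 r5 (t : R) :
  ratio_system k u v A B g r1 r2 r3 r4 r5 -> 0 < t ->
  Rabs (log_defect k u v A B g t) <= 49 * K_reg k + 16.
Proof.
  intros rs Ht.
  assert (Hsym : forall u v A B r1 r2 r4 r5, v <= u ->
    ratio_system k u v A B g r1 r2 r3 r4 r5 ->
    Rabs (log_defect k u v A B g t) <= 49 * K_reg k + 16).
  { clear - Ht; intros u v A B r1 r2 r4 r5 Hvu rs.
    destruct (Rle_lt_dec B A) as [HBA|HAB].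
    - now apply (log_defect_bounded_ordered k u v A B g r1 r2 r3 r4 r5).
    - replace (log_defect k u v A B g t) with (log_defect k u v B A g t).
      + apply (log_defect_bounded_ordered k u v B A g r1 r2 r3 r5 r4); auto; [|lra].
        now apply ratio_system_swap_even.
      + unfold log_defect; now replace (u + v + B + A) with (u + v + A + B) by ring. }
  destruct (Rle_lt_dec v u) as [Hvu|Huv].
  - now apply (Hsym u v A B r1 r2 r4 r5).
  - replace (log_defect k u v A B g t) with (log_defect k v u A B g t).
    + apply (Hsym v u A B r2 r1 r4 r5); [lra|].
      now apply ratio_system_swap_odd.
    + unfold log_defect; replace (v + u + A + B) with (u + v + A + B) by ring; ring.
Qed.

(** * Estimates for the six components at time 1 *)

Definition comparable (K f g : R) : Prop := g <= K * f /\ f <= K * g.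

(** The sum [/ (1 + u) + / (1 + v)] replaces [/ (1 + min(u, v))] at the cost of a factor 2. It frees
    the statement from any ordering of [u] and [v] and is smooth, which serves the passage to the
    walls. *)
Lemma ratio_even_bounds_at_1 k u v A B g r1 r2 r3 r4 r5 :
  ratio_system k u v A B g r1 r2 r3 r4 r5 ->
  c_even k / 2 * (/ (1 + u) + / (1 + v)) <= r4 1 * (1 + (u + v + B))
    <= C_even k * (/ (1 + u) + / (1 + v)) /\
  c_even k / 2 * (/ (1 + u) + / (1 + v)) <= r5 1 * (1 + (u + v + A))
    <= C_even k * (/ (1 + u) + / (1 + v)).
Proof.
  assert (Hone : forall c C y z d r : R, 0 < c -> 0 < C -> 0 < y <= z -> 0 < d ->
    c / ((1 + y * 1) * (1 + d * 1)) <= r <= C / ((1 + y * 1) * (1 + d * 1)) ->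
    c / 2 * (/ (1 + z) + / (1 + y)) <= r * (1 + d) <= C * (/ (1 + z) + / (1 + y))).
  { intros c C y z d r Hc HC Hyz Hd Hr; rewrite !Rmult_1_r in Hr.
    assert (Hz : 0 < / (1 + z)) by (apply Rinv_0_lt_compat; lra).
    assert (Hzy : / (1 + z) <= / (1 + y)) by (apply Rinv_le_contravar; lra).
    replace (c / ((1 + y) * (1 + d))) with (c * / (1 + y) * / (1 + d)) in Hr by (field; lra).
    replace (C / ((1 + y) * (1 + d))) with (C * / (1 + y) * / (1 + d)) in Hr by (field; lra).
    assert (Hl : c * / (1 + y) <= r * (1 + d)).
    { replace (c * / (1 + y)) with (c * / (1 + y) * / (1 + d) * (1 + d)) by (field; lra).
      apply Rmult_le_compat_r; lra. }
    assert (Hu : r * (1 + d) <= C * / (1 + y)).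
    { replace (C * / (1 + y)) with (C * / (1 + y) * / (1 + d) * (1 + d)) by (field; lra).
      apply Rmult_le_compat_r; lra. }
    assert (c * / (1 + z) <= c * / (1 + y)) by (apply Rmult_le_compat_l; lra).
    assert (0 < C * / (1 + z)) by nra. lra. }
  intros rs.
  pose proof rs as [pk pu pv pA pB pAB _ _ _ _ _ _ _ _ _ _ _ _ _ _ _ _].
  assert (Hc := c_even_pos k pk). assert (HC := C_even_pos k pk).
  destruct (Rle_lt_dec v u) as [Hvu|Huv].
  - destruct (ratio_even_bounds _ _ _ _ _ _ _ _ _ _ _ rs 1 Hvu Rlt_0_1) as [b4 b5].
    split; apply Hone; auto; lra.
  - destruct (ratio_even_bounds _ _ _ _ _ _ _ _ _ _ _
      (ratio_system_swap_odd _ _ _ _ _ _ _ _ _ _ _ rs) 1 (Rlt_le _ _ Huv) Rlt_0_1) as [b4 b5].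
    rewrite (Rplus_comm (/ (1 + u))), (Rplus_comm u v).
    split; apply Hone; auto; lra.
Qed.

Lemma comparable_mult (K0 K c C f r x y V : R) :
  0 < K0 -> 0 < c -> 0 < C -> 0 <= f -> 0 < V -> 0 <= y -> K0 * C <= K -> K0 / c <= K ->
  comparable K0 f V -> c * y <= r * x <= C * y -> comparable K (r * f * x) (V * y).
Proof.
  intros HK0 Hc HC Hf HV Hy K1 K2 [h1 h2] [h3 h4].
  assert (0 <= c * y) by nra.
  assert (0 <= V * y) by nra. assert (Hrx : 0 <= r * x) by lra.
  split.
  - apply Rle_trans with (K0 / c * (f * (c * y))).
    + replace (K0 / c * (f * (c * y))) with (K0 * f * y) by (field; lra).
      apply Rmult_le_compat_r; lra.
    + replace (r * f * x) with (f * (r * x)) by ring.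
      assert (f * (c * y) <= f * (r * x)) by (apply Rmult_le_compat_l; lra).
      assert (0 <= f * (c * y)) by (apply Rmult_le_pos; lra).
      apply Rle_trans with (K0 / c * (f * (r * x))).
      * apply Rmult_le_compat_l; [left; apply Rdiv_lt_0_compat; lra|lra].
      * apply Rmult_le_compat_r; lra.
  - replace (r * f * x) with (f * (r * x)) by ring.
    apply Rle_trans with (K0 * V * (C * y)).
    + apply Rmult_le_compat; try lra.
    + replace (K0 * V * (C * y)) with (K0 * C * (V * y)) by ring.
      apply Rmult_le_compat_r; lra.
Qed.

Lemma exp_le_compat (x y : R) : x <= y -> exp x <= exp y.
Proof. intros [H | ->]; [left; now apply exp_increasing|lra]. Qed.

Definition K_main (k : R) : R := exp (49 * K_reg k + 16)
  * (1 + C_odd k + / c_odd k + C_even k + 2 / c_even k).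

Lemma dunkl_system_estimates k u v A B g0 g1 g2 g3 g4 g5 :
  dunkl_system k u v A B g0 g1 g2 g3 g4 g5 ->
  let w := u + v + A + B in
  let V := exp (- (k * (ln (1 + u) + ln (1 + v) + ln (1 + w)))) in
  let s := / (1 + u) + / (1 + v) in
  comparable (K_main k) (g0 1) V /\
  comparable (K_main k) (g1 1 * (1 + u)) V /\
  comparable (K_main k) (g2 1 * (1 + v)) V /\
  comparable (K_main k) (g3 1 * (1 + w)) V /\
  comparable (K_main k) (g4 1 * (1 + (u + v + B))) (V * s) /\
  comparable (K_main k) (g5 1 * (1 + (u + v + A))) (V * s).
Proof.
  intros sys w V s.
  assert (rs := dunkl_ratio_system _ _ _ _ _ _ _ _ _ _ _ sys).
  pose proof rs as [pk pu pv pA pB pAB i0 _ gp _ _ _ _ _ _ _ _ _ _ _ _ _].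
  assert (Hg := gp 1 Rlt_0_1).
  assert (HV : 0 < V) by apply exp_pos.
  assert (Hc := c_odd_pos k pk). assert (Hce := c_even_pos k pk).
  assert (HCe := C_even_pos k pk). assert (HC : 0 < C_odd k) by (unfold C_odd; lra).
  assert (Hci : 0 < / c_odd k) by now apply Rinv_0_lt_compat.
  assert (Hcei : 0 < 2 / c_even k) by (apply Rdiv_lt_0_compat; lra).
  set (K0 := exp (49 * K_reg k + 16)).
  assert (HK0 : 0 < K0) by apply exp_pos.
  assert (Hbase : comparable K0 (g0 1) V).
  { assert (HL := log_defect_bounded _ _ _ _ _ _ _ _ _ _ _ 1 rs Rlt_0_1).
    unfold log_defect in HL; rewrite !Rmult_1_r in HL; fold w in HL.
    rewrite <- (exp_ln (g0 1)) by exact Hg.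
    apply Rabs_le_between in HL.
    unfold comparable, K0, V; rewrite <- !exp_plus.
    split; apply exp_le_compat; lra. }
  assert (HK : forall x, 0 <= x -> x <= 1 + C_odd k + / c_odd k + C_even k + 2 / c_even k ->
    K0 * x <= K_main k).
  { intros x Hx Hx'; unfold K_main; fold K0; apply Rmult_le_compat_l; lra. }
  destruct (ratio_odd_bounds _ _ _ _ _ _ _ _ _ _ _ rs 1 Rlt_0_1) as (b1 & b2 & b3).
  destruct (ratio_even_bounds_at_1 _ _ _ _ _ _ _ _ _ _ _ rs) as (b4 & b5).
  rewrite !Rmult_1_r in b1, b2, b3. fold w in b3. fold s in b4, b5.
  assert (Hw : 0 < w) by (unfold w; lra).
  assert (Hs : 0 < s).
  { apply Rplus_lt_0_compat; apply Rinv_0_lt_compat; lra. }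
  assert (Hone : forall (a f : R), 0 < a -> c_odd k / (1 + a) <= f / g0 1 <= C_odd k / (1 + a) ->
    comparable (K_main k) (f * (1 + a)) V).
  { intros a f Ha Hf.
    replace (f * (1 + a)) with (f / g0 1 * g0 1 * (1 + a)) by (field; lra).
    rewrite <- (Rmult_1_r V).
    apply (comparable_mult K0 (K_main k) (c_odd k) (C_odd k)); try lra.
    - apply HK; lra.
    - unfold Rdiv; apply HK; lra.
    - exact Hbase.
    - replace (c_odd k * 1) with (c_odd k / (1 + a) * (1 + a)) by (field; lra).
      replace (C_odd k * 1) with (C_odd k / (1 + a) * (1 + a)) by (field; lra).
      split; apply Rmult_le_compat_r; lra. }
  assert (Htwo : forall (a f : R), 0 < a ->
    c_even k / 2 * s <= f / g0 1 * (1 + a) <= C_even k * s ->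
    comparable (K_main k) (f * (1 + a)) (V * s)).
  { intros a f Ha Hf.
    replace (f * (1 + a)) with (f / g0 1 * g0 1 * (1 + a)) by (field; lra).
    apply (comparable_mult K0 (K_main k) (c_even k / 2) (C_even k)); try lra.
    - apply HK; lra.
    - replace (K0 / (c_even k / 2)) with (K0 * (2 / c_even k)) by (field; lra). apply HK; lra.
    - exact Hbase. }
  refine (conj _ (conj _ (conj _ (conj _ (conj _ _))))).
  - destruct Hbase as [h1 h2].
    assert (Hm : K0 <= K_main k) by (rewrite <- (Rmult_1_r K0); apply HK; lra).
    split; nra.
  - now apply Hone.
  - now apply Hone.
  - now apply Hone.
  - apply Htwo; [lra|exact b4].
  - apply Htwo; [lra|exact b5].
Qed.

(** * Continuity along lines from the double power series *)

Lemma Series_dominated (a b : nat -> R) (th : R) :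
  (forall n, Rabs (a n) <= th * b n) -> ex_series b ->
  ex_series a /\ Rabs (Series a) <= th * Series b.
Proof.
  intros Hab Hb.
  assert (Hs : ex_series (fun n => th * b n)).
  { apply (@ex_series_scal_l R_AbsRing); exact Hb. }
  assert (Ha : ex_series (fun n => Rabs (a n))).
  { apply (@ex_series_le R_AbsRing R_CompleteNormedModule _ (fun n => th * b n)); [|exact Hs].
    intros n; unfold norm; simpl; unfold abs; simpl; rewrite Rabs_Rabsolu; apply Hab. }
  split; [now apply ex_series_Rabs|].
  apply Rle_trans with (1 := Series_Rabs a Ha).
  rewrite <- Series_scal_l.
  apply Series_le; [|exact Hs].
  intros n; split; [apply Rabs_pos|apply Hab].
Qed.

Lemma monomial_bound (c s t r th : R) (i j : nat) : 0 <= th <= 1 -> 0 < r ->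
  Rabs s <= th * r -> Rabs t <= th * r ->
  Rabs (c * s ^ i * t ^ j) <= Rabs c * r ^ (i + j) * th ^ (i + j).
Proof.
  intros Hth Hr Hs Ht.
  rewrite !Rabs_mult, <- !RPow_abs, Rmult_assoc, (Rmult_assoc (Rabs c)).
  apply Rmult_le_compat_l; [apply Rabs_pos|].
  rewrite <- Rpow_mult_distr, (Rmult_comm r), pow_add.
  apply Rmult_le_compat; try (apply pow_le, Rabs_pos);
    apply pow_incr; split; auto; apply Rabs_pos.
Qed.

Lemma pow_le_1_id (x : R) (n : nat) : 0 <= x <= 1 -> x ^ S n <= x.
Proof.
  intros Hx; simpl.
  assert (0 <= x ^ n) by (apply pow_le; lra).
  assert (x ^ n <= 1) by (rewrite <- (pow1 n); apply pow_incr; lra). nra.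
Qed.

(** Shrinking both arguments by [th] gains at least one factor [th] in every monomial of positive
    degree, and the constant terms cancel. The modulus is thus linear in [th], and no uniform
    convergence argument is involved. *)
Lemma double_series_modulus (c : nat -> nat -> R) (r s t th : R) : 0 < r ->
  (forall i, ex_series (fun j => Rabs (c i j) * r ^ (i + j))) ->
  ex_series (fun i => Series (fun j => Rabs (c i j) * r ^ (i + j))) ->
  0 <= th <= 1 -> Rabs s <= th * r -> Rabs t <= th * r ->
  Rabs (Series (fun i => Series (fun j => c i j * s ^ i * t ^ j))
        - Series (fun i => Series (fun j => c i j * 0 ^ i * 0 ^ j)))
  <= th * Series (fun i => Series (fun j => Rabs (c i j) * r ^ (i + j))).
Proof.
  intros Hr Hi He Hth Hs Ht.
  pose (b := fun i j => Rabs (c i j) * r ^ (i + j)).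
  assert (Hb : forall i j, 0 <= b i j).
  { intros i j; apply Rmult_le_pos; [apply Rabs_pos|apply pow_le; lra]. }
  assert (H1 : forall x y, Rabs x <= r -> Rabs y <= r -> forall i j,
    Rabs (c i j * x ^ i * y ^ j) <= 1 * b i j).
  { intros x y Hx Hy i j.
    apply Rle_trans with (1 := monomial_bound (c i j) x y r 1 i j ltac:(lra) Hr ltac:(lra) ltac:(lra)).
    rewrite pow1; right; unfold b; ring. }
  assert (Hd : forall i j, Rabs (c i j * s ^ i * t ^ j - c i j * 0 ^ i * 0 ^ j) <= th * b i j).
  { intros i j; destruct (Nat.eq_dec (i + j) 0) as [Hij|Hij].
    - assert (i = 0%nat /\ j = 0%nat) as [-> ->] by lia.
      simpl; rewrite Rminus_diag, Rabs_R0; apply Rmult_le_pos; [lra|apply Hb].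
    - replace (c i j * 0 ^ i * 0 ^ j) with 0.
      + rewrite Rminus_0_r.
        apply Rle_trans with (1 := monomial_bound (c i j) s t r th i j Hth Hr Hs Ht).
        fold (b i j); rewrite (Rmult_comm th); apply Rmult_le_compat_l; [apply Hb|].
        destruct (i + j)%nat; [lia|now apply pow_le_1_id].
      + rewrite Rmult_assoc, <- pow_add, pow_i by lia; ring. }
  assert (Hsr : Rabs s <= r) by nra. assert (Htr : Rabs t <= r) by nra.
  assert (H0r : Rabs 0 <= r) by (rewrite Rabs_R0; lra).
  assert (Ea := fun x y hx hy i => Series_dominated _ _ 1 (H1 x y hx hy i) (Hi i)).
  assert (Eo := fun x y hx hy => Series_dominated
    (fun i => Series (fun j => c i j * x ^ i * y ^ j)) _ 1
    (fun i => proj2 (Ea x y hx hy i)) He).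
  rewrite <- Series_minus; [|apply Eo; assumption|apply Eo; assumption].
  apply Series_dominated; [|exact He].
  intros i; rewrite <- Series_minus; [|apply Ea; assumption|apply Ea; assumption].
  apply Series_dominated; [|apply Hi].
  intros j; apply Hd.
Qed.

Lemma analytic_continuous_line (f : vec -> R) (X xi : vec) :
  real_analytic_on_a f -> in_a X -> in_a xi ->
  continuous (fun t => f (vadd X (vscale t xi))) 0.
Proof.
  intros Hf HX Hxi.
  destruct (Hf X HX) as (r & c & Hr & Hi & He & Heq).
  set (M := Series (fun i => Series (fun j => Rabs (c i j) * r ^ (i + j)))) in *.
  (* The modulus at [s = t = 0] with [th = 1] bounds an absolute value by [M]. *)
  assert (HM : 0 <= M).
  { rewrite <- (Rmult_1_l M).
    apply Rle_trans with (2 := double_series_modulus c r 0 0 1 Hr Hi He ltac:(lra)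
      ltac:(rewrite Rabs_R0; lra) ltac:(rewrite Rabs_R0; lra)).
    apply Rabs_pos. }
  (* For [xi] in the plane, [xi = a alpha + b beta] with [a] the first coordinate and [b] minus the
     third. *)
  set (a := xc1 xi). set (b := - xc3 xi).
  assert (Hline : forall t, vadd X (vscale t xi)
    = vadd X (vadd (vscale (t * a) alpha_v) (vscale (t * b) beta_v))).
  { intros t; unfold in_a in Hxi; unfold vadd, vscale, mk, alpha_v, beta_v, mk, a, b, xc1, xc2, xc3 in *.
    destruct xi as [[p q] z]; simpl in *. assert (q = - p - z) by lra; subst q.
    f_equal; [f_equal|]; ring. }
  pose (m := 1 + Rabs a + Rabs b).
  assert (Hm : 1 <= m) by (unfold m; generalize (Rabs_pos a) (Rabs_pos b); lra).
  apply filterlim_locally; intros e.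
  (* The first bound keeps the point inside the polydisc and [th <= 1]; the second gives
     [th * M < e], with [M + 1] in place of [M] in case [M] vanishes. *)
  assert (Hd : 0 < Rmin (r / (2 * m)) (e * r / ((M + 1) * m))).
  { apply Rmin_glb_lt; apply Rdiv_lt_0_compat; try nra.
    apply Rmult_lt_0_compat; [apply cond_pos|exact Hr]. }
  exists (mkposreal _ Hd); intros t Ht.
  unfold ball in Ht; simpl in Ht; unfold AbsRing_ball, abs, minus, plus, opp in Ht; simpl in Ht.
  rewrite Ropp_0, Rplus_0_r in Ht.
  assert (Ht1 : Rabs t < r / (2 * m)) by (eapply Rlt_le_trans; [exact Ht|apply Rmin_l]).
  assert (Ht2 : Rabs t < e * r / ((M + 1) * m)) by (eapply Rlt_le_trans; [exact Ht|apply Rmin_r]).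
  clear Ht.
  assert (Htm1 : Rabs t * m < r / 2).
  { replace (r / 2) with (r / (2 * m) * m) by (field; lra). apply Rmult_lt_compat_r; lra. }
  assert (Htm2 : Rabs t * m * (M + 1) < e * r).
  { replace (e * r) with (e * r / ((M + 1) * m) * (m * (M + 1))) by (field; lra).
    rewrite Rmult_assoc; apply Rmult_lt_compat_r; nra. }
  assert (Hpt := Rabs_pos t). assert (Hpa := Rabs_pos a). assert (Hpb := Rabs_pos b).
  assert (Hsa : Rabs (t * a) <= Rabs t * m) by (rewrite Rabs_mult; unfold m; nra).
  assert (Hsb : Rabs (t * b) <= Rabs t * m) by (rewrite Rabs_mult; unfold m; nra).
  unfold ball; simpl; unfold AbsRing_ball, abs, minus, plus, opp; simpl.
  fold (f (vadd X (vscale t xi)) - f (vadd X (vscale 0 xi))).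
  rewrite !Hline, !Rmult_0_l.
  rewrite (Heq (t * a) (t * b)), (Heq 0 0) by (rewrite ?Rabs_R0; lra).
  set (th := Rabs t * m / r).
  assert (Hthr : th * r = Rabs t * m) by (unfold th; field; lra).
  assert (Hth : 0 <= th <= 1).
  { split; [apply Rdiv_le_0_compat; nra|]. apply Rle_div_l; nra. }
  eapply Rle_lt_trans.
  - apply (double_series_modulus c r (t * a) (t * b) th Hr Hi He Hth); rewrite Hthr; assumption.
  - fold M. apply Rmult_lt_reg_r with r; [exact Hr|].
    replace (th * M * r) with (th * r * M) by ring. rewrite Hthr.
    apply Rle_lt_trans with (2 := Htm2). nra.
Qed.

(** * From the Dunkl kernel to the linear system along a ray *)

Lemma vadd_vscale_0 (X xi : vec) : vadd X (vscale 0 xi) = X.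
Proof.
  destruct X as [[x1 x2] x3]; unfold vadd, vscale, mk, xc1, xc2, xc3; simpl.
  f_equal; [f_equal|]; ring.
Qed.

Lemma vscale_1 (X : vec) : vscale 1 X = X.
Proof.
  destruct X as [[x1 x2] x3]; unfold vscale, mk, xc1, xc2, xc3; simpl.
  f_equal; [f_equal|]; ring.
Qed.

(* Along the ray through [Z] the factors [<alpha, xi> / <alpha, X>] become [1 / t]. *)
Lemma dunkl_kernel_ray (k : R) (E : vec -> vec -> R) (L Z : vec) (t : R) :
  IsDunklKernel k E -> in_a L -> in_a Z ->
  alphaZ Z <> 0 -> betaZ Z <> 0 -> gammaZ Z <> 0 -> 0 < t ->
  is_derive (fun s => E (vscale s Z) L) t
    (inner Z L * E (vscale t Z) L + k / t * (E (vscale t (refl_alpha Z)) L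
      + E (vscale t (refl_beta Z)) L + E (vscale t (refl_gamma Z)) L
      - 3 * E (vscale t Z) L)).
Proof.
  intros hE HL HZ ha hb hg Ht.
  destruct (hE L HL) as (_ & _ & HD).
  assert (Hsa : alphaZ (vscale t Z) = t * alphaZ Z)
    by (unfold alphaZ, vscale, mk, xc1, xc2, xc3; simpl; ring).
  assert (Hsb : betaZ (vscale t Z) = t * betaZ Z)
    by (unfold betaZ, vscale, mk, xc1, xc2, xc3; simpl; ring).
  assert (Hsg : gammaZ (vscale t Z) = t * gammaZ Z)
    by (unfold gammaZ, vscale, mk, xc1, xc2, xc3; simpl; ring).
  assert (Hd : is_derive (fun s => E (vadd (vscale t Z) (vscale s Z)) L) 0
    (inner Z L * E (vscale t Z) L
     - dunkl_refl_part k (fun Y => E Y L) Z (vscale t Z))).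
  { apply HD; [|exact HZ|..].
    - unfold in_a in *; unfold vscale, mk, xc1, xc2, xc3 in *; simpl.
      rewrite <- !Rmult_plus_distr_l, HZ; ring.
    - rewrite Hsa; apply Rmult_integral_contrapositive; split; [lra|exact ha].
    - rewrite Hsb; apply Rmult_integral_contrapositive; split; [lra|exact hb].
    - rewrite Hsg; apply Rmult_integral_contrapositive; split; [lra|exact hg]. }
  (* The kernel equation differentiates at parameter 0 from a base point. Taking [vscale t Z] as
     base point and [Z] as direction, the shift [s - t] turns this into the derivative at [t] along
     the ray. *)
  apply (is_derive_ext (fun s => E (vadd (vscale t Z) (vscale (s - t) Z)) L)).
  { intros s; f_equal; unfold vadd, vscale, mk, xc1, xc2, xc3; simpl.
    f_equal; [f_equal|]; ring. }
  eapply is_derive_eq.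
  - apply (is_derive_comp (fun s => E (vadd (vscale t Z) (vscale s Z)) L) (fun s => s - t)).
    + rewrite Rminus_diag; exact Hd.
    + instantiate (1 := 1). auto_derive; [exact I|ring].
  - unfold scal; simpl; unfold mult; simpl.
    unfold dunkl_refl_part; rewrite Hsa, Hsb, Hsg.
    replace (inner alpha_v Z) with (alphaZ Z)
      by (unfold inner, alphaZ, alpha_v, mk, xc1, xc2, xc3; simpl; ring).
    replace (inner beta_v Z) with (betaZ Z)
      by (unfold inner, betaZ, beta_v, mk, xc1, xc2, xc3; simpl; ring).
    replace (inner gamma_v Z) with (gammaZ Z)
      by (unfold inner, gammaZ, gamma_v, mk, xc1, xc2, xc3; simpl; ring).
    change (refl_alpha (vscale t Z)) with (vscale t (refl_alpha Z)).
    change (refl_beta (vscale t Z)) with (vscale t (refl_beta Z)).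
    change (refl_gamma (vscale t Z)) with (vscale t (refl_gamma Z)).
    field; repeat split; auto; lra.
Qed.

Definition damped (E : vec -> vec -> R) (L : vec) (a : R) (Z : vec) (t : R) : R :=
  E (vscale t Z) L * exp (- (t * a)).

Lemma is_derive_damped (k : R) (E : vec -> vec -> R) (L Z : vec) (a t : R) :
  IsDunklKernel k E -> in_a L -> in_a Z ->
  alphaZ Z <> 0 -> betaZ Z <> 0 -> gammaZ Z <> 0 -> 0 < t ->
  is_derive (damped E L a Z) t
    ((inner Z L - a) * damped E L a Z t + k / t * (damped E L a (refl_alpha Z) t
      + damped E L a (refl_beta Z) t + damped E L a (refl_gamma Z) t
      - 3 * damped E L a Z t)).
Proof.
  intros hE HL HZ ha hb hg Ht.
  eapply is_derive_eq.
  - apply is_derive_Rmult; [now apply (dunkl_kernel_ray k E L Z t)|].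
    instantiate (1 := - a * exp (- (t * a))).
    auto_derive; [exact I|ring].
  - unfold damped; ring.
Qed.

Lemma continuous_damped (k : R) (E : vec -> vec -> R) (L Z : vec) (a : R) :
  IsDunklKernel k E -> in_a L -> in_a Z ->
  damped E L a Z 0 = 1 /\ continuous (damped E L a Z) 0.
Proof.
  intros hE HL HZ; destruct (hE L HL) as (Ha & H0 & _).
  assert (Hv : forall t, vadd (mk 0 0 0) (vscale t Z) = vscale t Z).
  { intros t; unfold vadd, vscale, mk, xc1, xc2, xc3; simpl.
    f_equal; [f_equal|]; ring. }
  split.
  - unfold damped; rewrite <- Hv, vadd_vscale_0, H0, Rmult_0_l, Ropp_0, exp_0; ring.
  - unfold damped; apply continuous_Rmult.
    + apply (continuous_ext (fun t => E (vadd (mk 0 0 0) (vscale t Z)) L)).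
      * intros t; now rewrite Hv.
      * apply (analytic_continuous_line (fun X => E X L)); [exact Ha| |exact HZ].
        unfold in_a, mk, xc1, xc2, xc3; simpl; ring.
    + apply (@ex_derive_continuous R_AbsRing R_NormedModule); auto_derive; exact I.
Qed.

Section Chamber.

Variables (k : R) (E : vec -> vec -> R).
Hypothesis hk : 0 < k.
Hypothesis hE : IsDunklKernel k E.
Variables l1 l2 l3 : R.
Hypothesis HL : l1 + l2 + l3 = 0.
Hypothesis Hl12 : l2 < l1.
Hypothesis Hl23 : l3 < l2.

Let L := mk l1 l2 l3.

Lemma kernel_dunkl_system (y1 y2 y3 : R) : y1 + y2 + y3 = 0 -> y2 < y1 -> y3 < y2 ->
  let a := l1 * y1 + l2 * y2 + l3 * y3 in
  dunkl_system k ((l1 - l2) * (y1 - y2)) ((l2 - l3) * (y2 - y3))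
    ((l1 - l2) * (y2 - y3)) ((l2 - l3) * (y1 - y2))
    (damped E L a (mk y1 y2 y3)) (damped E L a (mk y2 y1 y3)) (damped E L a (mk y1 y3 y2))
    (damped E L a (mk y3 y2 y1)) (damped E L a (mk y2 y3 y1)) (damped E L a (mk y3 y1 y2)).
Proof.
  intros Hy H12 H23 a.
  assert (HaL : in_a L) by exact HL.
  assert (hp : forall x1 x2 x3, x1 + x2 + x3 = 0 -> in_a (mk x1 x2 x3)) by (intros; assumption).
  assert (Hder : forall x1 x2 x3 t, x1 + x2 + x3 = 0 -> x1 <> x2 -> x2 <> x3 -> x1 <> x3 ->
    0 < t -> is_derive (damped E L a (mk x1 x2 x3)) t
    ((l1 * x1 + l2 * x2 + l3 * x3 - a) * damped E L a (mk x1 x2 x3) t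
     + k / t * (damped E L a (mk x2 x1 x3) t + damped E L a (mk x1 x3 x2) t
      + damped E L a (mk x3 x2 x1) t - 3 * damped E L a (mk x1 x2 x3) t))).
  { intros x1 x2 x3 t Hx n12 n23 n13 Ht.
    assert (D := is_derive_damped k E L (mk x1 x2 x3) a t hE HaL (hp _ _ _ Hx)).
    unfold alphaZ, betaZ, gammaZ, mk, xc1, xc2, xc3 in D; simpl in D.
    eapply is_derive_eq.
    - apply D; lra.
    - unfold inner, L, refl_alpha, refl_beta, refl_gamma, mk, xc1, xc2, xc3; simpl; ring. }
  assert (Hcont : forall x1 x2 x3, x1 + x2 + x3 = 0 -> damped E L a (mk x1 x2 x3) 0 = 1
    /\ continuous (damped E L a (mk x1 x2 x3)) 0).
  { intros x1 x2 x3 Hx; apply (continuous_damped k); auto. }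
  constructor; try (now apply Hcont; lra); try (apply Rmult_lt_0_compat; lra).
  - exact hk.
  - ring.
  - repeat split; apply Hcont; lra.
  - intros t Ht; eapply is_derive_eq; [apply Hder; lra|unfold a; ring].
  - intros t Ht; eapply is_derive_eq; [apply Hder; lra|unfold a; ring].
  - intros t Ht; eapply is_derive_eq; [apply Hder; lra|unfold a; ring].
  - intros t Ht; eapply is_derive_eq; [apply Hder; lra|unfold a; ring].
  - intros t Ht; eapply is_derive_eq; [apply Hder; lra|unfold a; ring].
  - intros t Ht; eapply is_derive_eq; [apply Hder; lra|unfold a; ring].
Qed.

(** * Estimates on the open chamber and their extension to the walls *)

(** On the closed chamber this is [wt L Y k k k], written with logarithms to match [log_defect] and
    to be differentiable up to the walls. *)
Definition main_weight (y1 y2 y3 : R) : R :=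
  exp (l1 * y1 + l2 * y2 + l3 * y3
    - k * (ln (1 + (l1 - l2) * (y1 - y2)) + ln (1 + (l2 - l3) * (y2 - y3))
           + ln (1 + (l1 - l3) * (y1 - y3)))).

(** The expected denominators multiply [E], so that each conjunct is an inequality between
    continuous functions and survives the limit to a wall. *)
Definition chamber_estimates (K y1 y2 y3 : R) : Prop :=
  let u := (l1 - l2) * (y1 - y2) in
  let v := (l2 - l3) * (y2 - y3) in
  let w := (l1 - l3) * (y1 - y3) in
  let A := (l1 - l2) * (y2 - y3) in
  let B := (l2 - l3) * (y1 - y2) in
  let V := main_weight y1 y2 y3 in
  let s := / (1 + u) + / (1 + v) in
  comparable K (E (mk y1 y2 y3) L * 1) V /\
  comparable K (E (mk y2 y1 y3) L * (1 + u)) V /\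
  comparable K (E (mk y1 y3 y2) L * (1 + v)) V /\
  comparable K (E (mk y3 y2 y1) L * (1 + w)) V /\
  comparable K (E (mk y2 y3 y1) L * (1 + (u + v + B))) (V * s) /\
  comparable K (E (mk y3 y1 y2) L * (1 + (u + v + A))) (V * s).

Lemma open_chamber_estimates (y1 y2 y3 : R) :
  y1 + y2 + y3 = 0 -> y2 < y1 -> y3 < y2 -> chamber_estimates (K_main k) y1 y2 y3.
Proof.
  intros Hy H12 H23.
  assert (D := dunkl_system_estimates _ _ _ _ _ _ _ _ _ _ _ (kernel_dunkl_system y1 y2 y3 Hy H12 H23)).
  simpl in D; unfold damped in D; rewrite !vscale_1, !Rmult_1_l in D.
  unfold chamber_estimates, main_weight.
  set (a := l1 * y1 + l2 * y2 + l3 * y3) in *.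
  set (u := (l1 - l2) * (y1 - y2)) in *. set (v := (l2 - l3) * (y2 - y3)) in *.
  set (A := (l1 - l2) * (y2 - y3)) in *. set (B := (l2 - l3) * (y1 - y2)) in *.
  replace ((l1 - l3) * (y1 - y3)) with (u + v + A + B) by (unfold u, v, A, B; ring).
  assert (Hsc : forall e x c, comparable (K_main k) (e * exp (- a) * x) c ->
    comparable (K_main k) (e * x) (exp a * c)).
  { intros e x c [h1 h2].
    assert (Ha : exp a * exp (- a) = 1) by (rewrite <- exp_plus, Rplus_opp_r, exp_0; reflexivity).
    assert (Hp := exp_pos a).
    split.
    - apply Rle_trans with (exp a * (K_main k * (e * exp (- a) * x))).
      + apply Rmult_le_compat_l; lra.
      + right; replace (exp a * (K_main k * (e * exp (- a) * x)))
          with (K_main k * (e * x) * (exp a * exp (- a))) by ring. rewrite Ha; ring.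
    - apply Rle_trans with (exp a * (e * exp (- a) * x)).
      + right; replace (exp a * (e * exp (- a) * x))
          with (e * x * (exp a * exp (- a))) by ring. rewrite Ha; ring.
      + replace (K_main k * (exp a * c)) with (exp a * (K_main k * c)) by ring.
        apply Rmult_le_compat_l; lra. }
  cbv zeta; set (q := k * (ln (1 + u) + ln (1 + v) + ln (1 + (u + v + A + B)))) in *.
  replace (exp (a - q)) with (exp a * exp (- q)) by (rewrite <- exp_plus; reflexivity).
  rewrite (Rmult_assoc (exp a)).
  destruct D as (D0 & D1 & D2 & D3 & D4 & D5).
  refine (conj _ (conj _ (conj _ (conj _ (conj _ _))))); apply Hsc; auto.
  rewrite Rmult_1_r; exact D0.
Qed.

Lemma comparable_limit (K : R) (f g : R -> R) : continuous f 0 -> continuous g 0 ->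
  (forall e, 0 < e -> comparable K (f e) (g e)) -> comparable K (f 0) (g 0).
Proof.
  assert (Hlim : forall p q : R -> R, continuous p 0 -> continuous q 0 ->
    (forall e, 0 < e -> p e <= q e) -> p 0 <= q 0).
  { intros p q Hp Hq Hle.
    destruct (Rle_lt_dec (p 0) (q 0)) as [|Hlt]; [assumption|exfalso].
    destruct (continuous_lt_locally (fun e => q e - p e) 0 0) as [d [Hd Hd']].
    - now apply continuous_Rminus.
    - lra.
    - assert (q (d / 2) - p (d / 2) < 0) by (apply Hd'; apply Rabs_def1; lra).
      specialize (Hle (d / 2)); lra. }
  intros Hf Hg Hcmp; split.
  - apply (Hlim g (fun e => K * f e)); auto.
    + apply continuous_Rmult; [apply continuous_const|exact Hf].
    + intros e He; apply Hcmp, He.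
  - apply (Hlim f (fun e => K * g e)); auto.
    + apply continuous_Rmult; [apply continuous_const|exact Hg].
    + intros e He; apply Hcmp, He.
Qed.

Lemma closed_chamber_estimates (y1 y2 y3 : R) :
  y1 + y2 + y3 = 0 -> y2 <= y1 -> y3 <= y2 -> chamber_estimates (K_main k) y1 y2 y3.
Proof.
  intros Hy H12 H23.
  assert (HaL : in_a L) by exact HL.
  destruct (hE L HaL) as (Han & _ & _).
  assert (HE : forall x1 x2 x3 z1 z2 z3, x1 + x2 + x3 = 0 -> z1 + z2 + z3 = 0 ->
    continuous (fun e => E (mk (x1 + e * z1) (x2 + e * z2) (x3 + e * z3)) L) 0).
  { intros x1 x2 x3 z1 z2 z3 Hx Hz.
    exact (analytic_continuous_line (fun X => E X L) (mk x1 x2 x3) (mk z1 z2 z3) Han Hx Hz). }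
  (* The direction [(1, 0, -1)] lies in the plane and strictly increases both gaps, so every point
     of the closed chamber is a limit of interior ones with the same constant. *)
  assert (Hopen : forall e, 0 < e ->
    chamber_estimates (K_main k) (y1 + e * 1) (y2 + e * 0) (y3 + e * -1)).
  { intros e He; apply open_chamber_estimates; lra. }
  assert (Hu : 0 <= (l1 - l2) * (y1 - y2)) by (apply Rmult_le_pos; lra).
  assert (Hv : 0 <= (l2 - l3) * (y2 - y3)) by (apply Rmult_le_pos; lra).
  assert (Hw : 0 <= (l1 - l3) * (y1 - y3)) by (apply Rmult_le_pos; lra).
  pose (V := fun e => main_weight (y1 + e * 1) (y2 + e * 0) (y3 + e * -1)).
  pose (s := fun e => / (1 + (l1 - l2) * (y1 + e * 1 - (y2 + e * 0)))
    + / (1 + (l2 - l3) * (y2 + e * 0 - (y3 + e * -1)))).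
  assert (HV : continuous V 0).
  { apply (@ex_derive_continuous R_AbsRing R_NormedModule).
    unfold V, main_weight; auto_derive; rewrite !Rmult_0_l, !Rplus_0_r; lra. }
  assert (Hs : continuous s 0).
  { apply (@ex_derive_continuous R_AbsRing R_NormedModule).
    unfold s; auto_derive; rewrite !Rmult_0_l, !Rplus_0_r; lra. }
  assert (H0 : forall x z, x = x + 0 * z) by (intros; ring).
  unfold chamber_estimates.
  rewrite (H0 y1 1), (H0 y2 0), (H0 y3 (-1)).
  refine (conj _ (conj _ (conj _ (conj _ (conj _ _))))).
  - apply (comparable_limit _
      (fun e => E (mk (y1 + e * 1) (y2 + e * 0) (y3 + e * -1)) L * 1) V);
      [apply continuous_Rmult; [apply HE; lra|apply continuous_const]|exact HV|].
    intros e He; apply (Hopen e He).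
  - apply (comparable_limit _ (fun e => E (mk (y2 + e * 0) (y1 + e * 1) (y3 + e * -1)) L
      * (1 + (l1 - l2) * (y1 + e * 1 - (y2 + e * 0)))) V); [|exact HV|].
    + apply continuous_Rmult; [apply HE; lra|].
      apply (@ex_derive_continuous R_AbsRing R_NormedModule); auto_derive; exact I.
    + intros e He; apply (Hopen e He).
  - apply (comparable_limit _ (fun e => E (mk (y1 + e * 1) (y3 + e * -1) (y2 + e * 0)) L
      * (1 + (l2 - l3) * (y2 + e * 0 - (y3 + e * -1)))) V); [|exact HV|].
    + apply continuous_Rmult; [apply HE; lra|].
      apply (@ex_derive_continuous R_AbsRing R_NormedModule); auto_derive; exact I.
    + intros e He; apply (Hopen e He).
  - apply (comparable_limit _ (fun e => E (mk (y3 + e * -1) (y2 + e * 0) (y1 + e * 1)) L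
      * (1 + (l1 - l3) * (y1 + e * 1 - (y3 + e * -1)))) V); [|exact HV|].
    + apply continuous_Rmult; [apply HE; lra|].
      apply (@ex_derive_continuous R_AbsRing R_NormedModule); auto_derive; exact I.
    + intros e He; apply (Hopen e He).
  - apply (comparable_limit _ (fun e => E (mk (y2 + e * 0) (y3 + e * -1) (y1 + e * 1)) L
      * (1 + ((l1 - l2) * (y1 + e * 1 - (y2 + e * 0)) + (l2 - l3) * (y2 + e * 0 - (y3 + e * -1))
        + (l2 - l3) * (y1 + e * 1 - (y2 + e * 0))))) (fun e => V e * s e)).
    + apply continuous_Rmult; [apply HE; lra|].
      apply (@ex_derive_continuous R_AbsRing R_NormedModule); auto_derive; exact I.
    + now apply continuous_Rmult.
    + intros e He; apply (Hopen e He).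
  - apply (comparable_limit _ (fun e => E (mk (y3 + e * -1) (y1 + e * 1) (y2 + e * 0)) L
      * (1 + ((l1 - l2) * (y1 + e * 1 - (y2 + e * 0)) + (l2 - l3) * (y2 + e * 0 - (y3 + e * -1))
        + (l1 - l2) * (y2 + e * 0 - (y3 + e * -1))))) (fun e => V e * s e)).
    + apply continuous_Rmult; [apply HE; lra|].
      apply (@ex_derive_continuous R_AbsRing R_NormedModule); auto_derive; exact I.
    + now apply continuous_Rmult.
    + intros e He; apply (Hopen e He).
Qed.

End Chamber.

(** * Translation into the weights of the statement *)

(** All exponents in the statement are [k] or [k + 1]; a Boolean for each root lets [wt_bump] treat
    every weight at once. *)
Definition bump (b : bool) (k : R) : R := if b then k + 1 else k.
Definition select (b : bool) (x : R) : R := if b then x else 1.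

Lemma Rpower_bump (b : bool) (x k : R) : 0 < x -> Rpower x (bump b k) = Rpower x k * select b x.
Proof.
  intros Hx; destruct b; simpl; [|ring].
  now rewrite Rpower_plus, Rpower_1.
Qed.

Lemma wt_bump (k l1 l2 l3 y1 y2 y3 : R) (a b c : bool) :
  0 <= (l1 - l2) * (y1 - y2) -> 0 <= (l2 - l3) * (y2 - y3) -> 0 <= (l1 - l3) * (y1 - y3) ->
  wt (mk l1 l2 l3) (mk y1 y2 y3) (bump a k) (bump b k) (bump c k)
  = main_weight k l1 l2 l3 y1 y2 y3 * / (select a (1 + (l1 - l2) * (y1 - y2))
    * select b (1 + (l2 - l3) * (y2 - y3)) * select c (1 + (l1 - l3) * (y1 - y3))).
Proof.
  intros Hu Hv Hw.
  unfold wt, main_weight, inner, alphaZ, betaZ, gammaZ, mk, xc1, xc2, xc3; simpl.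
  rewrite !Rpower_bump by lra.
  assert (Hs : forall d x, 0 <= x -> select d (1 + x) <> 0) by (intros [] x Hx; simpl; lra).
  assert (Ha := Hs a _ Hu). assert (Hb := Hs b _ Hv). assert (Hc := Hs c _ Hw).
  assert (Hexp : forall S p q r,
    exp (S - k * (p + q + r)) = exp S * / (exp (k * p) * exp (k * q) * exp (k * r))).
  { intros S p q r; rewrite <- !exp_plus, <- exp_Ropp, <- exp_plus; f_equal; ring. }
  rewrite Hexp; unfold Rpower; field; repeat split; auto; apply Rgt_not_eq, exp_pos.
Qed.

(** The system yields [f] of order [V s / d], the statement asks for [V T]; the factor 4 leaves room
    for [s] and [T d] to agree only up to a constant. *)
Lemma asymp_of_comparable (K f V s d T : R) : 0 < K -> 0 < V -> 0 < T -> 0 < d ->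
  s <= 4 * (T * d) -> T * d <= 4 * s ->
  comparable K (f * d) (V * s) -> asymp (4 * K) f (V * T).
Proof.
  intros HK HV HT Hd h1 h2 [c1 c2]; unfold asymp; split.
  - apply Rmult_le_reg_l with (4 * K * d); [apply Rmult_lt_0_compat; lra|].
    replace (4 * K * d * (/ (4 * K) * (V * T))) with (V * (T * d)) by (field; lra).
    apply Rle_trans with (V * (4 * s)); [apply Rmult_le_compat_l; lra|].
    lra.
  - apply Rmult_le_reg_r with d; [exact Hd|].
    apply Rle_trans with (1 := c2).
    replace (4 * K * (V * T) * d) with (K * (V * (4 * (T * d)))) by ring.
    apply Rmult_le_compat_l; [lra|]. apply Rmult_le_compat_l; lra.
Qed.

Ltac sort_entries :=
  unfold Xplus, mk, xc1, xc2, xc3; simpl; f_equal; [f_equal|];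
  unfold Rmax, Rmin; repeat destruct Rle_dec; lra.

Lemma Xplus_permutations (y1 y2 y3 : R) : y1 >= y2 -> y2 >= y3 ->
  Xplus (mk y2 y1 y3) = mk y1 y2 y3 /\ Xplus (mk y1 y3 y2) = mk y1 y2 y3 /\
  Xplus (mk y3 y2 y1) = mk y1 y2 y3 /\ Xplus (mk y2 y3 y1) = mk y1 y2 y3 /\
  Xplus (mk y3 y1 y2) = mk y1 y2 y3.
Proof. intros H1 H2; repeat split; sort_entries. Qed.

Lemma K_main_pos (k : R) : 0 < k -> 0 < K_main k.
Proof.
  intros Hk; unfold K_main.
  assert (0 < / c_odd k) by (apply Rinv_0_lt_compat, c_odd_pos, Hk).
  assert (0 < 2 / c_even k) by (apply Rdiv_lt_0_compat; [lra|now apply c_even_pos]).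
  assert (HC := C_even_pos k Hk). assert (0 < C_odd k) by (unfold C_odd; lra).
  apply Rmult_lt_0_compat; [apply exp_pos|lra].
Qed.

Lemma inverse_sum_bounds (x y : R) : 0 <= x <= y ->
  / (1 + x) <= / (1 + x) + / (1 + y) <= 2 * / (1 + x).
Proof.
  intros H.
  assert (0 < / (1 + y)) by (apply Rinv_0_lt_compat; lra).
  assert (/ (1 + y) <= / (1 + x)) by (apply Rinv_le_contravar; lra). lra.
Qed.

(** A rotation has size [V s / (1 + rate)], where [s = (2 + u + v) / ((1 + u) (1 + v))]. If the
    extra term [A] or [B] of its rate is at most [v] or [u], the rate is of order [u + v] and
    cancels the numerator of [s]. Otherwise the other extra term is the dominated one, the rate is
    of order [w], and [s] is of order [/ (1 + min(u, v))], which yields the two subcases. *)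
Lemma chamber_asymp (k : R) (E : vec -> vec -> R) (l1 l2 l3 y1 y2 y3 : R) :
  0 < k -> IsDunklKernel k E -> l1 + l2 + l3 = 0 -> l2 < l1 -> l3 < l2 ->
  y1 + y2 + y3 = 0 -> y2 <= y1 -> y3 <= y2 ->
  let L := mk l1 l2 l3 in
  let Y := mk y1 y2 y3 in
  let K := 4 * K_main k in
  asymp K (E (mk y1 y2 y3) L) (wt L Y k k k) /\
  asymp K (E (mk y2 y1 y3) L) (wt L Y (k + 1) k k) /\
  asymp K (E (mk y1 y3 y2) L) (wt L Y k (k + 1) k) /\
  asymp K (E (mk y3 y2 y1) L) (wt L Y k k (k + 1)) /\
  (l1 - l2 <= l2 - l3 -> asymp K (E (mk y3 y1 y2) L) (wt L Y (k + 1) (k + 1) k)) /\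
  (l2 - l3 <= l1 - l2 ->
   ((l2 - l3) * (y2 - y3) <= (l1 - l2) * (y1 - y2) ->
      asymp K (E (mk y3 y1 y2) L) (wt L Y k (k + 1) (k + 1))) /\
   ((l1 - l2) * (y1 - y2) <= (l2 - l3) * (y2 - y3) ->
      asymp K (E (mk y3 y1 y2) L) (wt L Y (k + 1) k (k + 1)))) /\
  (l2 - l3 <= l1 - l2 -> asymp K (E (mk y2 y3 y1) L) (wt L Y (k + 1) (k + 1) k)) /\
  (l1 - l2 <= l2 - l3 ->
   ((l2 - l3) * (y2 - y3) <= (l1 - l2) * (y1 - y2) ->
      asymp K (E (mk y2 y3 y1) L) (wt L Y k (k + 1) (k + 1))) /\
   ((l1 - l2) * (y1 - y2) <= (l2 - l3) * (y2 - y3) ->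
      asymp K (E (mk y2 y3 y1) L) (wt L Y (k + 1) k (k + 1)))).
Proof.
  intros hk hE HL Hl12 Hl23 Hy H12 H23 L Y K.
  assert (HK := K_main_pos k hk).
  destruct (closed_chamber_estimates k E hk hE l1 l2 l3 HL Hl12 Hl23 y1 y2 y3 Hy H12 H23)
    as (e0 & e1 & e2 & e3 & e4 & e5).
  assert (HA : l1 - l2 <= l2 - l3 -> (l1 - l2) * (y2 - y3) <= (l2 - l3) * (y2 - y3)).
  { intros; apply Rmult_le_compat_r; lra. }
  assert (HB : l2 - l3 <= l1 - l2 -> (l2 - l3) * (y1 - y2) <= (l1 - l2) * (y1 - y2)).
  { intros; apply Rmult_le_compat_r; lra. }
  assert (HA' : 0 <= (l1 - l2) * (y2 - y3)) by (apply Rmult_le_pos; lra).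
  assert (HB' : 0 <= (l2 - l3) * (y1 - y2)) by (apply Rmult_le_pos; lra).
  assert (Hu : 0 <= (l1 - l2) * (y1 - y2)) by (apply Rmult_le_pos; lra).
  assert (Hv : 0 <= (l2 - l3) * (y2 - y3)) by (apply Rmult_le_pos; lra).
  assert (Hw : 0 <= (l1 - l3) * (y1 - y3)) by (apply Rmult_le_pos; lra).
  assert (Hwt := fun a b c => wt_bump k l1 l2 l3 y1 y2 y3 a b c Hu Hv Hw).
  fold L Y in Hwt. fold L in e0, e1, e2, e3, e4, e5.
  assert (HV : 0 < main_weight k l1 l2 l3 y1 y2 y3) by apply exp_pos.
  set (V := main_weight k l1 l2 l3 y1 y2 y3) in *.
  assert (Hwuv : (l1 - l3) * (y1 - y3) = (l1 - l2) * (y1 - y2) + (l2 - l3) * (y2 - y3)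
    + (l1 - l2) * (y2 - y3) + (l2 - l3) * (y1 - y2)) by ring.
  set (u := (l1 - l2) * (y1 - y2)) in *. set (v := (l2 - l3) * (y2 - y3)) in *.
  set (w := (l1 - l3) * (y1 - y3)) in *.
  set (A := (l1 - l2) * (y2 - y3)) in *. set (B := (l2 - l3) * (y1 - y2)) in *.
  clearbody u v w A B V.
  assert (Hone : forall f d, 0 < d -> comparable (K_main k) (f * d) V ->
    asymp K f (V * / d)).
  { intros f d Hd Hf; apply (asymp_of_comparable _ _ _ 1 d); auto.
    - now apply Rinv_0_lt_compat.
    - rewrite Rinv_l; lra.
    - rewrite Rinv_l; lra.
    - now rewrite Rmult_1_r. }
  (* First alternative: the extra term [D] is absorbed by [u + v], and the weight is the product
     [/ ((1 + u) * (1 + v))]. *)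
  assert (Hprod : forall f D, 0 <= D -> D <= u \/ D <= v ->
    comparable (K_main k) (f * (1 + (u + v + D))) (V * (/ (1 + u) + / (1 + v))) ->
    asymp K f (V * / ((1 + u) * (1 + v)))).
  { intros f D HD HDuv Hf.
    assert (Hq : 0 < / ((1 + u) * (1 + v))).
    { apply Rinv_0_lt_compat, Rmult_lt_0_compat; lra. }
    replace (/ (1 + u) + / (1 + v)) with (/ ((1 + u) * (1 + v)) * (2 + u + v)) in Hf
      by (field; lra).
    set (q := / ((1 + u) * (1 + v))) in *.
    apply (asymp_of_comparable _ _ _ _ _ _ HK HV) with (5 := Hf); [exact Hq|lra| |].
    - replace (4 * (q * (1 + (u + v + D)))) with (q * (4 * (1 + (u + v + D)))) by ring.
      apply Rmult_le_compat_l; lra.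
    - replace (4 * (q * (2 + u + v))) with (q * (4 * (2 + u + v))) by ring.
      apply Rmult_le_compat_l; lra. }
  (* Second alternative: [d] is half of [1 + w] or more, and [x] stands for the smaller of [u] and
     [v]. *)
  assert (Hmin : forall f s d x, 0 <= x -> 0 < d -> d <= 1 + w <= 2 * d ->
    / (1 + x) <= s <= 2 * / (1 + x) ->
    comparable (K_main k) (f * d) (V * s) -> asymp K f (V * / ((1 + x) * (1 + w)))).
  { intros f s d x Hx Hd Hdw Hs Hf.
    assert (Hq : 0 < / (1 + x)) by (apply Rinv_0_lt_compat; lra).
    assert (Hz : / (1 + w) * (1 + w) = 1) by (apply Rinv_l; lra).
    assert (Hz' : 0 < / (1 + w)) by (apply Rinv_0_lt_compat; lra).
    rewrite Rinv_mult.
    apply (asymp_of_comparable _ _ _ _ _ _ HK HV) with (5 := Hf);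
      [now apply Rmult_lt_0_compat|exact Hd| |]; rewrite Rmult_assoc.
    - assert (1 / 2 <= / (1 + w) * d) by nra.
      assert (/ (1 + x) * (1 / 2) <= / (1 + x) * (/ (1 + w) * d)) by (apply Rmult_le_compat_l; lra).
      lra.
    - assert (/ (1 + w) * d <= 1) by nra.
      assert (/ (1 + x) * (/ (1 + w) * d) <= / (1 + x) * 1) by (apply Rmult_le_compat_l; lra).
      lra. }
  assert (w000 := Hwt false false false). assert (w100 := Hwt true false false).
  assert (w010 := Hwt false true false). assert (w001 := Hwt false false true).
  assert (w110 := Hwt true true false). assert (w101 := Hwt true false true).
  assert (w011 := Hwt false true true).
  simpl in w000, w100, w010, w001, w110, w101, w011.
  refine (conj _ (conj _ (conj _ (conj _ (conj _ (conj _ (conj _ _))))))).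
  - rewrite w000, ?Rmult_1_r, ?Rmult_1_l; apply Hone; [lra|exact e0].
  - rewrite w100, ?Rmult_1_r, ?Rmult_1_l; apply Hone; [lra|exact e1].
  - rewrite w010, ?Rmult_1_r, ?Rmult_1_l; apply Hone; [lra|exact e2].
  - rewrite w001, ?Rmult_1_r, ?Rmult_1_l; apply Hone; [lra|exact e3].
  - intros Hl; rewrite w110, ?Rmult_1_r, ?Rmult_1_l; apply (Hprod _ A); auto.
  - intros Hl; specialize (HB Hl); split; intros Huv.
    + rewrite w011, ?Rmult_1_r, ?Rmult_1_l; apply (Hmin _ _ _ v Hv) with (4 := e5); [lra|lra|].
      rewrite (Rplus_comm (/ (1 + u))); apply inverse_sum_bounds; lra.
    + rewrite w101, ?Rmult_1_r, ?Rmult_1_l; apply (Hmin _ _ _ u Hu) with (4 := e5); [lra|lra|].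
      apply inverse_sum_bounds; lra.
  - intros Hl; rewrite w110, ?Rmult_1_r, ?Rmult_1_l; apply (Hprod _ B); auto.
  - intros Hl; specialize (HA Hl); split; intros Huv.
    + rewrite w011, ?Rmult_1_r, ?Rmult_1_l; apply (Hmin _ _ _ v Hv) with (4 := e4); [lra|lra|].
      rewrite (Rplus_comm (/ (1 + u))); apply inverse_sum_bounds; lra.
    + rewrite w101, ?Rmult_1_r, ?Rmult_1_l; apply (Hmin _ _ _ u Hu) with (4 := e4); [lra|lra|].
      apply inverse_sum_bounds; lra.
Qed.

Theorem theorem2 (k : R) (hk : 0 < k) (E : vec -> vec -> R)
  (hE : IsDunklKernel k E) :
  exists K : R, 0 < K /\
  forall L X : vec, in_Cplus L -> in_a X ->
  (* (i) *)
  (xc1 X >= xc2 X /\ xc2 X >= xc3 X ->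
     asymp K (E X L) (wt L X k k k)) /\
  (* (ii) *)
  (xc2 X >= xc1 X /\ xc1 X >= xc3 X ->
     asymp K (E X L) (wt L (Xplus X) (k + 1) k k)) /\
  (xc1 X >= xc3 X /\ xc3 X >= xc2 X ->
     asymp K (E X L) (wt L (Xplus X) k (k + 1) k)) /\
  (* (iii) *)
  (xc2 X >= xc3 X /\ xc3 X >= xc1 X ->
     (alphaZ L <= betaZ L ->
        asymp K (E X L) (wt L (Xplus X) (k + 1) (k + 1) k)) /\
     (alphaZ L >= betaZ L ->
      alphaZ L * alphaZ (Xplus X) >= betaZ L * betaZ (Xplus X) ->
        asymp K (E X L) (wt L (Xplus X) k (k + 1) (k + 1))) /\
     (alphaZ L >= betaZ L ->
      alphaZ L * alphaZ (Xplus X) <= betaZ L * betaZ (Xplus X) ->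
        asymp K (E X L) (wt L (Xplus X) (k + 1) k (k + 1)))) /\
  (* (iv) *)
  (xc3 X >= xc1 X /\ xc1 X >= xc2 X ->
     (betaZ L <= alphaZ L ->
        asymp K (E X L) (wt L (Xplus X) (k + 1) (k + 1) k)) /\
     (betaZ L >= alphaZ L ->
      alphaZ L * alphaZ (Xplus X) >= betaZ L * betaZ (Xplus X) ->
        asymp K (E X L) (wt L (Xplus X) k (k + 1) (k + 1))) /\
     (betaZ L >= alphaZ L ->
      alphaZ L * alphaZ (Xplus X) <= betaZ L * betaZ (Xplus X) ->
        asymp K (E X L) (wt L (Xplus X) (k + 1) k (k + 1)))) /\
  (* (v) *)
  (xc3 X >= xc2 X /\ xc2 X >= xc1 X ->
     asymp K (E X L) (wt L (Xplus X) k k (k + 1))).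
Proof.
  assert (HK := K_main_pos k hk).
  exists (4 * K_main k); split; [lra|].
  intros [[l1 l2] l3] [[x1 x2] x3] (HL & Hl12 & Hl23) HX.
  unfold in_a, xc1, xc2, xc3 in HL, Hl12, Hl23, HX; simpl in HL, Hl12, Hl23, HX.
  change (xc1 (x1, x2, x3)) with x1; change (xc2 (x1, x2, x3)) with x2;
  change (xc3 (x1, x2, x3)) with x3.
  change (l1, l2, l3) with (mk l1 l2 l3); change (x1, x2, x3) with (mk x1 x2 x3).
  change (alphaZ (mk l1 l2 l3)) with (l1 - l2).
  change (betaZ (mk l1 l2 l3)) with (l2 - l3).
  assert (Hest := fun y1 y2 y3 => chamber_asymp k E l1 l2 l3 y1 y2 y3 hk hE HL Hl12 Hl23).
  cbv zeta in Hest.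
  refine (conj _ (conj _ (conj _ (conj _ (conj _ _))))); intros [h1 h2].
  - apply (Hest x1 x2 x3); lra.
  - destruct (Xplus_permutations x2 x1 x3 h1 h2) as (-> & _).
    apply (Hest x2 x1 x3); lra.
  - destruct (Xplus_permutations x1 x3 x2 h1 h2) as (_ & -> & _).
    apply (Hest x1 x3 x2); lra.
  (* With the sorted point [Y = (x2, x3, x1)], the point [X] is [(y3, y1, y2)], the rotation of rate
     [u + v + A]. *)
  - destruct (Xplus_permutations x2 x3 x1 h1 h2) as (_ & _ & _ & _ & ->).
    change (alphaZ (mk x2 x3 x1)) with (x2 - x3); change (betaZ (mk x2 x3 x1)) with (x3 - x1).
    destruct (Hest x2 x3 x1) as (_ & _ & _ & _ & g1 & g2 & _); [lra..|].
    refine (conj _ (conj _ _)).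
    + exact g1.
    + intros Hl Huv; apply g2; lra.
    + intros Hl Huv; apply g2; lra.
  (* With the sorted point [Y = (x3, x1, x2)], the point [X] is [(y2, y3, y1)], the rotation of rate
     [u + v + B]. *)
  - destruct (Xplus_permutations x3 x1 x2 h1 h2) as (_ & _ & _ & -> & _).
    change (alphaZ (mk x3 x1 x2)) with (x3 - x1); change (betaZ (mk x3 x1 x2)) with (x1 - x2).
    destruct (Hest x3 x1 x2) as (_ & _ & _ & _ & _ & _ & g1 & g2); [lra..|].
    refine (conj _ (conj _ _)).
    + exact g1.
    + intros Hl Huv; apply g2; lra.
    + intros Hl Huv; apply g2; lra.
  - destruct (Xplus_permutations x3 x2 x1 h1 h2) as (_ & _ & -> & _).
    apply (Hest x3 x2 x1); lra.
Qed.
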